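(* Let $s>1$, $a\in\mathbb{R}\setminus\{1\}$, $\kappa,\alpha\in\mathbb{R}$, and let $(u,\rho)\in C^\infty(J,C^\infty(\mathbb{S}^1)\oplus C^\infty(\mathbb{S}^1))$ be a solution, with maximal time interval of existence $J\ni0$, of the system $$m_t=\alpha u_x-au_xm-um_x-\kappa\rho\rho_x,\quad m=Au,\qquad\rho_t=-u\rho_x-(a-1)u_x\rho,\qquad\alpha_t=0,$$ where $A=(1-D^2)^s$. Suppose that $\|u_x\|_\infty$ is bounded on every bounded subinterval of $J$. Then, for every integer $k\ge0$, the quantity $$\|m\|_{H^k}^2+\|\rho\|_{H^{k+1}}^2$$ is also bounded on every bounded subinterval of $J$.
   Context: $\mathbb{S}^1=\mathbb{R}/2\pi\mathbb{Z}$ is the circle, with the measure $dx$ normalised to total mass $1$; $D=d/dx$, and $A=(1-D^2)^s$ is the Fourier multiplier $Ae^{ikx}=(1+k^2)^se^{ikx}$, $k\in\mathbb{Z}$. All functions are real valued; subscripts $t,x$ denote partial derivatives. $\|\cdot\|_\infty$ is the supremum norm on $\mathbb{S}^1$, and $\|\cdot\|_{H^k}$ is the usual Sobolev norm on $H^k(\mathbb{S}^1)$, $\|f\|_{H^k}=\big(\sum_{n\in\mathbb{Z}}(1+n^2)^k|\hat f_n|^2\big)^{1/2}$ with $\hat f_n$ the Fourier coefficients of $f$ (so $H^0=L_2$). *)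

(* Defs.v *)
From Stdlib Require Export Reals ZArith.
From Coquelicot Require Export Coquelicot.

Open Scope R_scope.

(** ** Functions on the circle

    Functions on R/2piZ are 2pi-periodic functions on R. *)

Definition periodic (f : R -> R) : Prop := forall x, f (x + 2 * PI) = f x.

Definition smooth_circle (f : R -> R) : Prop :=
  periodic f /\ forall (n : nat) (x : R), ex_derive_n f n x.

(* Extended-real valued, so that an unbounded function has norm [p_infty]. *)
Definition supnorm (f : R -> R) : Rbar :=
  Lub_Rbar (fun y => exists x, y = Rabs (f x)).

(* The n-th coefficient, the integral of f(x) e^{-inx} for the measure dx/(2pi),
   by real and imaginary parts. *)
Definition fourier_coef (f : R -> R) (n : Z) : C :=
  ( / (2 * PI) * RInt (fun x => f x * cos (IZR n * x)) 0 (2 * PI),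
    - (/ (2 * PI) * RInt (fun x => f x * sin (IZR n * x)) 0 (2 * PI)) ).

Definition expi (y : R) : C := (cos y, sin y).

Fixpoint Zpartial (c : Z -> R) (N : nat) : R :=
  match N with
  | O => c 0%Z
  | S N' => Zpartial c N' + (c (Z.of_nat N) + c (- Z.of_nat N)%Z)
  end.

(* For nonnegative terms this is the sum in [0, +oo]. *)
Definition Zseries (c : Z -> R) : Rbar := Lim_seq (Zpartial c).

(* (1 - D^2)^s.  For real f the terms of index n and -n are complex conjugate,
   so the sum of the complex terms equals the sum of their real parts. *)
Definition Aop (s : R) (f : R -> R) (x : R) : R :=
  real (Zseries (fun n =>
    Rpower (1 + IZR n ^ 2) s * Re (fourier_coef f n * expi (IZR n * x))%C)).

Definition Rbar_sqrt (x : Rbar) : Rbar :=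
  match x with Finite r => Finite (sqrt r) | _ => x end.

Definition Rbar_sqr (x : Rbar) : Rbar := Rbar_mult x x.

(* Extended-real valued: [p_infty] when f is not in H^k. *)
Definition sobolev_norm (k : nat) (f : R -> R) : Rbar :=
  Rbar_sqrt (Zseries (fun n =>
    (1 + IZR n ^ 2) ^ k * Cmod (fourier_coef f n) ^ 2)).

(** ** Time intervals *)

Definition convex_set (I : R -> Prop) : Prop :=
  forall t1 t2 t, I t1 -> I t2 -> t1 <= t <= t2 -> I t.

Definition open_interval (J : R -> Prop) : Prop := open J /\ convex_set J.

(* The closure of I need not be contained in J. *)
Definition bounded_subinterval (I J : R -> Prop) : Prop :=
  convex_set I /\ (forall t, I t -> J t) /\
  exists B, forall t, I t -> Rabs t <= B.

(** ** Smooth curves in the Frechet space of smooth functions on the circle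

    The topology is given by the seminorms f |-> sup |D^k f|. *)

Definition curve_derivative (J : R -> Prop) (U V : R -> R -> R) : Prop :=
  forall t, J t -> forall (k : nat) (eps : posreal),
    locally' 0 (fun h : R =>
      Rbar_lt
        (supnorm (Derive_n (fun x => (U (t + h) x - U t x) / h - V t x) k))
        eps).

(* [V n] is the n-th time derivative; only values at times in J (an open
   interval) matter. *)
Definition smooth_curve (J : R -> Prop) (U : R -> R -> R) : Prop :=
  exists V : nat -> R -> R -> R,
    V 0%nat = U /\
    (forall n t, J t -> smooth_circle (V n t)) /\
    (forall n, curve_derivative J (V n) (V (S n))).

(** ** The system *)

Record solution (s a kappa : R) (J : R -> Prop)
    (u rho : R -> R -> R) (alpha : R -> R) : Prop := {
  sol_u_smooth : smooth_curve J u;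
  sol_rho_smooth : smooth_curve J rho;
  sol_m_eq :
    let m := fun t => Aop s (u t) in
    forall t x, J t ->
      is_derive (fun t' => m t' x) t
        (alpha t * Derive (u t) x - a * Derive (u t) x * m t x
         - u t x * Derive (m t) x - kappa * rho t x * Derive (rho t) x);
  sol_rho_eq :
    forall t x, J t ->
      is_derive (fun t' => rho t' x) t
        (- u t x * Derive (rho t) x - (a - 1) * Derive (u t) x * rho t x);
  sol_alpha_eq : forall t, J t -> is_derive alpha t 0
}.

Definition maximal_solution (s a kappa : R) (J : R -> Prop)
    (u rho : R -> R -> R) (alpha : R -> R) : Prop :=
  open_interval J /\ J 0 /\ solution s a kappa J u rho alpha /\
  forall (J' : R -> Prop) (u' rho' : R -> R -> R) (alpha' : R -> R),
    open_interval J' -> (forall t, J t -> J' t) ->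
    solution s a kappa J' u' rho' alpha' ->
    (forall t, J t ->
       (forall x, u' t x = u t x /\ rho' t x = rho t x) /\
       alpha' t = alpha t) ->
    forall t, J' t -> J t.

(* F is bounded above on every bounded subinterval of J. *)
Definition bounded_on_bounded_subintervals (J : R -> Prop) (F : R -> Rbar)
    : Prop :=
  forall I, bounded_subinterval I J ->
    exists M : R, forall t, I t -> Rbar_le (F t) M.

(* Main.v *)
Require Import Defs.
From Stdlib Require Import Lra Lia Psatz FunctionalExtensionality.

(** The proof is an energy estimate. For each k let
    E_k = 1 + int |D^k m|^2 + int |D^(k+1) rho|^2. Applying D^k to the equation of m and
    D^(k+1) to that of rho gives equations of the form w_t = - u w_x + P, where P is a
    sum of products of derivatives of u, m and rho. Integration by parts reduces the
    contribution of - u w_x to int u_x w^2, which the bound on u_x controls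
    (transport_energy). Induction on k shows that the L2 norm of P is at most a constant
    times E_k^(1/2): in each product one factor is bounded by the lower orders and the
    other one is controlled by E_k (regularity_induction). So |E_k'| <= C E_k, and
    Gronwall's inequality bounds E_k on any bounded interval around 0.

    Two facts feed the induction. First, A is elliptic of order at least 2: its symbol
    (1+n^2)^s dominates n^2, so Parseval's identity for u and Bessel's inequality for m
    give |D^(j+2) u| <= |D^j m| in L2 (L2sq_second_derivative). This rests on the
    completeness of the trigonometric system, proved for smooth functions by
    Dirichlet's argument (Fourier_inversion). Second, for k = 0 one needs a sup bound
    on rho; it comes from the integrals of rho^(2p), whose exponential growth rates are
    at most a constant times p, by letting p tend to infinity (transport_sup).

    To differentiate the energies in time, A is shown to be a continuous linear
    operator on smooth functions, so that m = A u is a differentiable curve in that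
    space with derivative A u_t (flow_multiplier). Finally the Sobolev norms are
    compared with integrals of squares of derivatives (sobolev_norm_sqr). *)

(** * Smooth functions on the circle *)

Lemma Derive_n_Derive : forall f n x, Derive_n (Derive f) n x = Derive_n f (S n) x.
Proof.
intros f n x.
change (Derive f) with (Derive_n f 1).
rewrite Derive_n_comp. f_equal; lia.
Qed.

(** Bounding the order of differentiation lets closure under products be proved by
    induction on it, since one derivative of a product is a sum of products. *)
Definition Ck (n : nat) (f : R -> R) : Prop :=
  forall k x, (k <= n)%nat -> ex_derive_n f k x.

Lemma Ck_S : forall n f,
  Ck (S n) f <-> (forall x, ex_derive f x) /\ Ck n (Derive f).
Proof.
intros n f; split.
- intros H; split.
  + intros x. exact (H 1%nat x ltac:(lia)).
  + intros [|k] x Hk; [exact Logic.I|].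
    cbn [ex_derive_n].
    apply ex_derive_ext with (Derive_n f (S k)).
    { intros t. symmetry. apply Derive_n_Derive. }
    exact (H (S (S k)) x ltac:(lia)).
- intros [H1 H2] [|[|k]] x Hk; [exact Logic.I|apply H1|].
  cbn [ex_derive_n].
  apply ex_derive_ext with (Derive_n (Derive f) k).
  { intros t. apply Derive_n_Derive. }
  exact (H2 (S k) x ltac:(lia)).
Qed.

Lemma Ck_le : forall n m f, (m <= n)%nat -> Ck n f -> Ck m f.
Proof. intros n m f Hmn H k x Hk. apply H. lia. Qed.

Lemma Ck_const : forall n c, Ck n (fun _ => c).
Proof.
induction n; intros c.
- intros [|k] x Hk; [exact Logic.I|lia].
- apply Ck_S; split.
  + intros x. apply ex_derive_const.
  + replace (Derive (fun _ => c)) with (fun _ : R => 0); [apply IHn|].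
    apply functional_extensionality; intros x. symmetry; apply Derive_const.
Qed.

Lemma Ck_plus : forall n f g, Ck n f -> Ck n g -> Ck n (fun x => f x + g x).
Proof.
induction n; intros f g Hf Hg.
- intros [|k] x Hk; [exact Logic.I|lia].
- apply Ck_S in Hf; apply Ck_S in Hg. destruct Hf as [Hf Hf'], Hg as [Hg Hg'].
  apply Ck_S; split.
  + intros x. now apply @ex_derive_plus.
  + replace (Derive (fun x => f x + g x)) with (fun x => Derive f x + Derive g x).
    * now apply IHn.
    * apply functional_extensionality; intros x. symmetry; now apply Derive_plus.
Qed.

Lemma Ck_mult : forall n f g, Ck n f -> Ck n g -> Ck n (fun x => f x * g x).
Proof.
induction n; intros f g Hf Hg.
- intros [|k] x Hk; [exact Logic.I|lia].
- assert (Hf0 := Ck_le (S n) n _ (le_S _ _ (le_n n)) Hf).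
  assert (Hg0 := Ck_le (S n) n _ (le_S _ _ (le_n n)) Hg).
  apply Ck_S in Hf; apply Ck_S in Hg. destruct Hf as [Hf Hf'], Hg as [Hg Hg'].
  apply Ck_S; split.
  + intros x. now apply @ex_derive_mult.
  + replace (Derive (fun x => f x * g x))
      with (fun x => Derive f x * g x + f x * Derive g x).
    * apply Ck_plus; now apply IHn.
    * apply functional_extensionality; intros x. symmetry; now apply Derive_mult.
Qed.

Lemma Ck_trig : forall n a b c,
  Ck n (fun x => a * cos (c * x) + b * sin (c * x)).
Proof.
induction n; intros a b c.
- intros [|k] x Hk; [exact Logic.I|lia].
- apply Ck_S; split.
  + intros x. auto_derive; auto.
  + replace (Derive (fun x => a * cos (c * x) + b * sin (c * x)))
      with (fun x => (b * c) * cos (c * x) + (- a * c) * sin (c * x)); [apply IHn|].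
    apply functional_extensionality; intros x.
    symmetry; apply is_derive_unique. auto_derive; auto. ring.
Qed.

Lemma smooth_Ck : forall f,
  smooth_circle f <-> periodic f /\ forall n, Ck n f.
Proof.
intros f; split; intros [H1 H2]; split; auto.
- intros n k x _. apply H2.
- intros n x. exact (H2 n n x (le_n n)).
Qed.

Lemma smooth_const : forall c, smooth_circle (fun _ => c).
Proof.
intros c; apply smooth_Ck; split; [now intros x|]. intros n; apply Ck_const.
Qed.

Lemma smooth_plus : forall f g, smooth_circle f -> smooth_circle g ->
  smooth_circle (fun x => f x + g x).
Proof.
intros f g [Pf Hf]%smooth_Ck [Pg Hg]%smooth_Ck; apply smooth_Ck; split.
- intros x. now rewrite Pf, Pg.
- intros n; now apply Ck_plus.
Qed.

Lemma smooth_mult : forall f g, smooth_circle f -> smooth_circle g ->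
  smooth_circle (fun x => f x * g x).
Proof.
intros f g [Pf Hf]%smooth_Ck [Pg Hg]%smooth_Ck; apply smooth_Ck; split.
- intros x. now rewrite Pf, Pg.
- intros n; now apply Ck_mult.
Qed.

Lemma smooth_scal : forall c f, smooth_circle f -> smooth_circle (fun x => c * f x).
Proof. intros c f Hf. apply smooth_mult; [apply smooth_const|exact Hf]. Qed.

Lemma smooth_opp : forall f, smooth_circle f -> smooth_circle (fun x => - f x).
Proof.
intros f Hf. replace (fun x => - f x) with (fun x => -1 * f x).
- now apply smooth_scal.
- apply functional_extensionality; intros x; ring.
Qed.

Lemma smooth_minus : forall f g, smooth_circle f -> smooth_circle g ->
  smooth_circle (fun x => f x - g x).
Proof. intros f g Hf Hg. apply smooth_plus; [exact Hf|now apply smooth_opp]. Qed.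

Lemma smooth_pow : forall f n, smooth_circle f -> smooth_circle (fun x => f x ^ n).
Proof.
intros f n Hf; induction n; simpl; [apply smooth_const|now apply smooth_mult].
Qed.

Lemma smooth_ex_derive : forall f x, smooth_circle f -> ex_derive f x.
Proof. intros f x [_ H]. exact (H 1%nat x). Qed.

Lemma smooth_continuous : forall f x, smooth_circle f -> continuous f x.
Proof. intros f x Hf. apply (@ex_derive_continuous R_AbsRing R_NormedModule f x);
  now apply smooth_ex_derive. Qed.

Lemma smooth_Derive : forall f, smooth_circle f -> smooth_circle (Derive f).
Proof.
intros f Hf. assert (Hf' := Hf). apply smooth_Ck in Hf'; destruct Hf' as [P H].
apply smooth_Ck; split.
- intros x. unfold Derive. f_equal. apply Lim_ext. intros h.
  now rewrite <- (P x), <- (P (x + h)), (Rplus_assoc x h), (Rplus_comm h), <- Rplus_assoc.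
- intros n. exact (proj2 (proj1 (Ck_S n f) (H (S n)))).
Qed.

Lemma smooth_Derive_n : forall f n, smooth_circle f -> smooth_circle (Derive_n f n).
Proof.
intros f n Hf; induction n as [|n IH]; [exact Hf|].
exact (smooth_Derive _ IH).
Qed.

Lemma Derive_n_S_fun : forall f n, Derive_n f (S n) = Derive_n (Derive f) n.
Proof.
intros f n. apply functional_extensionality; intros x. symmetry; apply Derive_n_Derive.
Qed.

Lemma Derive_n_comp_fun : forall f m n, Derive_n (Derive_n f m) n = Derive_n f (n + m).
Proof. intros. apply functional_extensionality; intros x. apply Derive_n_comp. Qed.

Lemma Derive_plus_fun : forall f g, smooth_circle f -> smooth_circle g ->
  Derive (fun x => f x + g x) = fun x => Derive f x + Derive g x.
Proof.
intros f g Hf Hg. apply functional_extensionality; intros x.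
apply Derive_plus; now apply smooth_ex_derive.
Qed.

Lemma Derive_mult_fun : forall f g, smooth_circle f -> smooth_circle g ->
  Derive (fun x => f x * g x) = fun x => Derive f x * g x + f x * Derive g x.
Proof.
intros f g Hf Hg. apply functional_extensionality; intros x.
apply Derive_mult; now apply smooth_ex_derive.
Qed.

Lemma Derive_n_plus_fun : forall f g n, smooth_circle f -> smooth_circle g ->
  Derive_n (fun x => f x + g x) n = fun x => Derive_n f n x + Derive_n g n x.
Proof.
intros f g n; revert f g; induction n as [|n IH]; intros f g Hf Hg; [reflexivity|].
rewrite !Derive_n_S_fun, Derive_plus_fun by assumption.
now apply IH; apply smooth_Derive.
Qed.

Lemma Derive_n_scal_fun : forall c f n,
  Derive_n (fun x => c * f x) n = fun x => c * Derive_n f n x.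
Proof.
intros c f n. apply functional_extensionality; intros x. apply Derive_n_scal_l.
Qed.

Lemma Derive_n_minus_fun : forall f g n, smooth_circle f -> smooth_circle g ->
  Derive_n (fun x => f x - g x) n = fun x => Derive_n f n x - Derive_n g n x.
Proof.
intros f g n Hf Hg.
replace (fun x => f x - g x) with (fun x => f x + -1 * g x)
  by (apply functional_extensionality; intros; ring).
rewrite Derive_n_plus_fun, Derive_n_scal_fun by auto using smooth_scal.
apply functional_extensionality; intros; ring.
Qed.

(** * Integration over the circle *)

Notation integrable f := (ex_RInt (V := R_NormedModule) f 0 (2 * PI)).

Definition integral (f : R -> R) : R := RInt f 0 (2 * PI).

Lemma two_PI_pos : 0 < 2 * PI.
Proof. generalize PI_RGT_0; lra. Qed.

Lemma ex_int : forall f, (forall x, continuous f x) -> integrable f.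
Proof. intros f H. apply (@ex_RInt_continuous R_CompleteNormedModule). intros; apply H. Qed.

Lemma smooth_ex_int : forall f, smooth_circle f -> integrable f.
Proof. intros f H. apply ex_int. intros x; now apply smooth_continuous. Qed.

Lemma ex_int_scal : forall c f, integrable f -> integrable (fun x => c * f x).
Proof. intros c f Hf. exact (ex_RInt_scal (V := R_NormedModule) f 0 (2 * PI) c Hf). Qed.

Lemma ex_int_plus : forall f g, integrable f -> integrable g ->
  integrable (fun x => f x + g x).
Proof. intros f g Hf Hg. exact (ex_RInt_plus (V := R_NormedModule) f g 0 (2 * PI) Hf Hg). Qed.

Lemma ex_int_minus : forall f g, integrable f -> integrable g ->
  integrable (fun x => f x - g x).
Proof. intros f g Hf Hg. exact (ex_RInt_minus (V := R_NormedModule) f g 0 (2 * PI) Hf Hg). Qed.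

Lemma int_plus : forall f g, integrable f -> integrable g ->
  integral (fun x => f x + g x) = integral f + integral g.
Proof. intros f g Hf Hg. exact (RInt_plus f g 0 (2 * PI) Hf Hg). Qed.

Lemma int_scal : forall c f, integrable f -> integral (fun x => c * f x) = c * integral f.
Proof. intros c f Hf. exact (RInt_scal f 0 (2 * PI) c Hf). Qed.

Lemma int_minus : forall f g, integrable f -> integrable g ->
  integral (fun x => f x - g x) = integral f - integral g.
Proof. intros f g Hf Hg. exact (RInt_minus f g 0 (2 * PI) Hf Hg). Qed.

Lemma int_const : forall c, integral (fun _ => c) = 2 * PI * c.
Proof. intros c. unfold integral. rewrite RInt_const. unfold scal; simpl. unfold mult;
  simpl. ring. Qed.

Lemma int_ext : forall f g, (forall x, f x = g x) -> integral f = integral g.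
Proof. intros f g H. apply RInt_ext. intros; apply H. Qed.

Lemma int_ext_in : forall f g, (forall x, 0 < x < 2 * PI -> f x = g x) ->
  integral f = integral g.
Proof.
intros f g H. apply RInt_ext. intros x Hx.
rewrite Rmin_left, Rmax_right in Hx by (generalize two_PI_pos; lra). now apply H.
Qed.

Lemma int_le : forall f g, integrable f -> integrable g ->
  (forall x, f x <= g x) -> integral f <= integral g.
Proof.
intros f g Hf Hg H. apply RInt_le; auto. generalize two_PI_pos; lra.
Qed.

Lemma int_abs_bound : forall f M, integrable f ->
  (forall x, 0 <= x <= 2 * PI -> Rabs (f x) <= M) -> Rabs (integral f) <= 2 * PI * M.
Proof.
intros f M Hf H. replace (2 * PI) with (2 * PI - 0) by ring.
apply abs_RInt_le_const; auto. generalize two_PI_pos; lra.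
Qed.

Lemma int_abs : forall f g, integrable f -> integrable g ->
  (forall x, Rabs (f x) <= g x) -> Rabs (integral f) <= integral g.
Proof.
intros f g Hf Hg H. apply Rabs_le; split.
- replace (- integral g) with (-1 * integral g) by ring. rewrite <- int_scal by auto.
  apply int_le; auto.
  + apply (ex_RInt_scal g 0 (2 * PI) (-1) Hg).
  + intros x. specialize (H x). apply Rabs_le_between in H. lra.
- apply int_le; auto. intros x. eapply Rle_trans; [apply Rle_abs|apply H].
Qed.

Lemma int_Derive : forall f, smooth_circle f -> integral (Derive f) = 0.
Proof.
intros f Hf. unfold integral. rewrite RInt_Derive.
- destruct Hf as [P _]. specialize (P 0). rewrite Rplus_0_l in P. lra.
- intros; now apply smooth_ex_derive.
- intros; now apply smooth_continuous, smooth_Derive.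
Qed.

Lemma int_parts : forall f g, smooth_circle f -> smooth_circle g ->
  integral (fun x => Derive f x * g x) = - integral (fun x => f x * Derive g x).
Proof.
intros f g Hf Hg.
assert (H := int_Derive _ (smooth_mult _ _ Hf Hg)).
rewrite Derive_mult_fun in H by assumption.
rewrite int_plus in H; [lra| |]; apply smooth_ex_int, smooth_mult; auto using smooth_Derive.
Qed.

Definition L2sq (f : R -> R) : R := integral (fun x => f x ^ 2).

Lemma smooth_sqr : forall f, smooth_circle f -> smooth_circle (fun x => f x ^ 2).
Proof. intros; now apply smooth_pow. Qed.

Lemma L2sq_nonneg : forall f, smooth_circle f -> 0 <= L2sq f.
Proof.
intros f Hf. replace 0 with (integral (fun _ => 0)) by (rewrite int_const; ring).
apply int_le; auto using smooth_ex_int, smooth_const, smooth_sqr.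
intros x; apply pow2_ge_0.
Qed.

Lemma L2sq_plus : forall f g, smooth_circle f -> smooth_circle g ->
  L2sq (fun x => f x + g x) <= 2 * L2sq f + 2 * L2sq g.
Proof.
intros f g Hf Hg. unfold L2sq.
rewrite <- !int_scal, <- int_plus by auto using smooth_ex_int, smooth_sqr, smooth_scal.
apply int_le; auto using smooth_ex_int, smooth_sqr, smooth_scal, smooth_plus.
intros x. generalize (pow2_ge_0 (f x - g x)); lra.
Qed.

Lemma L2sq_scal : forall c f, smooth_circle f -> L2sq (fun x => c * f x) = c ^ 2 * L2sq f.
Proof.
intros c f Hf. unfold L2sq. rewrite <- int_scal by auto using smooth_ex_int, smooth_sqr.
apply int_ext; intros x; ring.
Qed.

Lemma L2sq_mult_sup : forall f g B, smooth_circle f -> smooth_circle g ->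
  (forall x, f x ^ 2 <= B) -> L2sq (fun x => f x * g x) <= B * L2sq g.
Proof.
intros f g B Hf Hg H. unfold L2sq. rewrite <- int_scal by auto using smooth_ex_int, smooth_sqr.
apply int_le; auto using smooth_ex_int, smooth_sqr, smooth_scal, smooth_mult.
intros x. specialize (H x). generalize (pow2_ge_0 (g x)). nra.
Qed.

Lemma int_mult_abs : forall f g, smooth_circle f -> smooth_circle g ->
  2 * Rabs (integral (fun x => f x * g x)) <= L2sq f + L2sq g.
Proof.
intros f g Hf Hg.
assert (H : Rabs (integral (fun x => f x * g x))
  <= integral (fun x => / 2 * (f x ^ 2 + g x ^ 2))).
{ apply int_abs; auto using smooth_ex_int, smooth_sqr, smooth_scal, smooth_mult, smooth_plus.
  intros x. apply Rabs_le. generalize (pow2_ge_0 (f x - g x)) (pow2_ge_0 (f x + g x)). lra. }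
rewrite int_scal, int_plus in H by auto using smooth_ex_int, smooth_sqr, smooth_plus.
fold (L2sq f) (L2sq g) in H. lra.
Qed.

Lemma periodic_INR : forall f (n : nat) x, periodic f -> f (x + INR n * (2 * PI)) = f x.
Proof.
intros f n x P; induction n as [|n IH].
- simpl. f_equal. ring.
- rewrite S_INR. rewrite <- IH, <- (P (x + INR n * (2 * PI))). f_equal. ring.
Qed.

Lemma periodic_reduce : forall f x, periodic f ->
  exists y, 0 <= y <= 2 * PI /\ f y = f x.
Proof.
intros f x P. assert (H := two_PI_pos).
set (k := Int_part (x / (2 * PI))).
destruct (base_Int_part (x / (2 * PI))) as [H1 H2]. fold k in H1, H2.
assert (Hx : x = x / (2 * PI) * (2 * PI)) by (field; lra).
exists (x - IZR k * (2 * PI)). split.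
- split; nra.
- destruct (Z_le_gt_dec 0 k) as [Hk|Hk].
  + rewrite <- (periodic_INR f (Z.to_nat k) _ P).
    rewrite INR_IZR_INZ, Z2Nat.id by lia. f_equal. ring.
  + rewrite <- (periodic_INR f (Z.to_nat (- k)) x P).
    rewrite INR_IZR_INZ, Z2Nat.id by lia. rewrite opp_IZR. f_equal. ring.
Qed.

Lemma smooth_bounded : forall f, smooth_circle f -> exists B, forall x, Rabs (f x) <= B.
Proof.
intros f Hf.
destruct (continuity_ab_maj (fun x => Rabs (f x)) 0 (2 * PI)) as [z [Hz _]].
- generalize two_PI_pos; lra.
- intros c _. apply continuity_pt_filterlim.
  apply (continuous_comp f Rabs); [now apply smooth_continuous|apply continuous_Rabs].
- exists (Rabs (f z)). intros x.
  destruct (periodic_reduce f x (proj1 Hf)) as [y [Hy <-]]. now apply Hz.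
Qed.

Lemma RInt_sub_le_integral : forall g a b, smooth_circle g -> (forall x, 0 <= g x) ->
  0 <= a <= b -> b <= 2 * PI -> RInt g a b <= integral g.
Proof.
intros g a b Hg Hpos Ha Hb.
assert (Hgi : forall p q, ex_RInt g p q).
{ intros p q. apply (@ex_RInt_continuous R_CompleteNormedModule).
  intros; now apply smooth_continuous. }
assert (E : integral g = RInt g 0 a + RInt g a b + RInt g b (2 * PI)).
{ unfold integral. rewrite <- (RInt_Chasles g 0 b) by auto.
  now rewrite <- (RInt_Chasles g 0 a b) by auto. }
assert (0 <= RInt g 0 a) by (apply RInt_ge_0; auto; lra).
assert (0 <= RInt g b (2 * PI)) by (apply RInt_ge_0; auto; lra).
lra.
Qed.

(** One-dimensional Sobolev embedding: the values of f^2 at x and y differ by at most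
    the integral of |2 f f'| <= f^2 + f'^2, and averaging over y replaces f(y)^2 by the
    mean of f^2. *)
Lemma sup_le_L2sq : forall f x, smooth_circle f -> f x ^ 2 <= 2 * (L2sq f + L2sq (Derive f)).
Proof.
intros f x Hf.
assert (Hf' := smooth_Derive _ Hf).
assert (P := two_PI_pos).
destruct (periodic_reduce f x (proj1 Hf)) as [x0 [Hx0 <-]].
assert (Hs := smooth_sqr _ Hf). assert (Hs' := smooth_sqr _ Hf').
set (g := fun z => f z ^ 2 + Derive f z ^ 2).
assert (Hg : smooth_circle g) by now apply smooth_plus.
assert (Hgi : forall a b, ex_RInt g a b).
{ intros a b. apply (@ex_RInt_continuous R_CompleteNormedModule). intros;
  now apply smooth_continuous. }
assert (Hgpos : forall z, 0 <= g z).
{ intros z; unfold g. generalize (pow2_ge_0 (f z)) (pow2_ge_0 (Derive f z)); lra. }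
assert (K : forall p q, 0 <= p <= q -> q <= 2 * PI -> Rabs (f q ^ 2 - f p ^ 2) <= integral g).
{ intros p q Hpq Hq.
  assert (E : f q ^ 2 - f p ^ 2 = RInt (Derive (fun z => f z ^ 2)) p q).
  { symmetry. apply RInt_Derive; intros; [now apply smooth_ex_derive|].
    now apply smooth_continuous, smooth_Derive. }
  rewrite E.
  assert (Rabs (RInt (Derive (fun z => f z ^ 2)) p q) <= RInt g p q).
  { eapply Rle_trans; [apply abs_RInt_le; [lra|]|].
    - apply (@ex_RInt_continuous R_CompleteNormedModule). intros;
      now apply smooth_continuous, smooth_Derive.
    - apply RInt_le; [lra| |apply Hgi|].
      + apply (@ex_RInt_continuous R_CompleteNormedModule). intros z _.
        apply (continuous_comp _ Rabs);
          [now apply smooth_continuous, smooth_Derive|apply continuous_Rabs].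
      + intros z _.
        replace (Derive (fun z0 => f z0 ^ 2) z) with (2 * f z * Derive f z).
        * apply Rabs_le. unfold g.
          generalize (pow2_ge_0 (f z - Derive f z)) (pow2_ge_0 (f z + Derive f z)). lra.
        * symmetry. apply is_derive_unique.
          auto_derive; [now apply smooth_ex_derive|]. change (fun x1 : R => f x1) with f.
          ring. }
  assert (B := RInt_sub_le_integral g p q Hg Hgpos Hpq Hq). lra. }
assert (K2 : 2 * PI * (f x0 ^ 2 - integral g) <= L2sq f).
{ rewrite <- int_const. apply RInt_le; [lra| | |].
  - apply smooth_ex_int, smooth_const.
  - now apply smooth_ex_int.
  - intros y Hy. destruct (Rle_dec x0 y) as [h|h].
    + specialize (K x0 y ltac:(lra) ltac:(lra)). apply Rabs_le_between in K. lra.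
    + specialize (K y x0 ltac:(lra) ltac:(lra)). apply Rabs_le_between in K. lra. }
assert (E : integral g = L2sq f + L2sq (Derive f)) by (apply int_plus;
  now apply smooth_ex_int).
assert (H0 := L2sq_nonneg _ Hf). assert (H1 := L2sq_nonneg _ Hf').
rewrite E in K2. generalize PI2_1; intros HP. nra.
Qed.

(** * Two-sided series *)

Lemma Zpartial_ext : forall c d N, (forall n, c n = d n) -> Zpartial c N = Zpartial d N.
Proof. intros c d N H; induction N as [|N IH]; simpl; [apply H|now rewrite IH, !H]. Qed.

Lemma Zpartial_le : forall c d N, (forall n, c n <= d n) -> Zpartial c N <= Zpartial d N.
Proof.
intros c d N H; induction N as [|N IH]; cbn [Zpartial]; [apply H|].
generalize (H (Z.of_nat (S N))) (H (- Z.of_nat (S N))%Z); lra.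
Qed.

Lemma Zpartial_plus : forall c d N,
  Zpartial (fun n => c n + d n) N = Zpartial c N + Zpartial d N.
Proof. intros c d N; induction N as [|N IH]; cbn [Zpartial]; [reflexivity|rewrite IH;
  ring]. Qed.

Lemma Zpartial_scal : forall k c N,
  Zpartial (fun n => k * c n) N = k * Zpartial c N.
Proof. intros k c N; induction N as [|N IH]; cbn [Zpartial]; [reflexivity|rewrite IH;
  ring]. Qed.

Lemma Zpartial_nonneg : forall c N, (forall n, 0 <= c n) -> 0 <= Zpartial c N.
Proof.
intros c N H; induction N as [|N IH]; cbn [Zpartial]; [apply H|].
generalize (H (Z.of_nat (S N))) (H (- Z.of_nat (S N))%Z); lra.
Qed.

(** For n >= 1 one has 1/(1+n^2) <= 2 (1/n - 1/(n+1)), so the tail telescopes; the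
    factor 4 appears because n and -n both contribute. *)
Lemma Zpartial_tail : forall c K, 0 <= K ->
  (forall n, Rabs (c n) <= K * / (1 + IZR n ^ 2)) ->
  forall N M, (N <= M)%nat ->
  Rabs (Zpartial c M - Zpartial c N) <= 4 * K * (/ INR (S N) - / INR (S M)).
Proof.
intros c K HK Hc N M HNM. induction HNM as [|M HNM IH].
- unfold Rminus. rewrite !Rplus_opp_r, Rabs_R0. lra.
- cbn [Zpartial].
  assert (E : forall n, IZR n ^ 2 = INR (S M) ^ 2 ->
    Rabs (c n) <= 2 * K * (/ INR (S M) - / INR (S (S M)))).
  { intros n En. eapply Rle_trans; [apply Hc|]. rewrite En.
    replace (2 * K * (/ INR (S M) - / INR (S (S M))))
      with (K * (2 * (/ INR (S M) - / INR (S (S M))))) by ring.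
    apply Rmult_le_compat_l; auto.
    assert (0 < INR (S M)) by (apply lt_0_INR; lia).
    assert (1 <= INR (S M)) by (apply (le_INR 1); lia).
    rewrite (S_INR (S M)). set (z := INR (S M)) in *.
    replace (2 * (/ z - / (z + 1))) with (2 / (z * (z + 1))) by (field; lra).
    apply Rmult_le_reg_l with (1 + z ^ 2); [nra|].
    rewrite Rinv_r by nra.
    apply Rmult_le_reg_r with (z * (z + 1)); [nra|].
    field_simplify; [nra|lra]. }
  assert (E1 := E (Z.of_nat (S M))). assert (E2 := E (- Z.of_nat (S M))%Z).
  rewrite opp_IZR in E2. rewrite <- INR_IZR_INZ in E1, E2.
  specialize (E1 eq_refl). specialize (E2 ltac:(ring)).
  replace (Zpartial c M + (c (Z.of_nat (S M)) + c (- Z.of_nat (S M))%Z) - Zpartial c N)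
    with ((Zpartial c M - Zpartial c N) + (c (Z.of_nat (S M)) + c (- Z.of_nat (S M))%Z))
      by ring.
  eapply Rle_trans; [apply Rabs_triang|].
  eapply Rle_trans; [apply Rplus_le_compat_l, Rabs_triang|]. lra.
Qed.

Lemma inv_INR_small : forall eps, 0 < eps -> exists N, forall n, (N <= n)%nat ->
  / INR (S n) < eps.
Proof.
intros eps H. destruct (archimed_cor1 eps H) as [N [H1 H2]]. exists N. intros n Hn.
eapply Rle_lt_trans; [|exact H1]. apply Rinv_le_contravar; [now apply lt_0_INR|].
apply le_INR; lia.
Qed.

Lemma Zpartial_cauchy : forall c K, 0 <= K ->
  (forall n, Rabs (c n) <= K * / (1 + IZR n ^ 2)) ->
  forall N M, (N <= M)%nat ->
  Rabs (Zpartial c M - Zpartial c N) <= 4 * K * / INR (S N).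
Proof.
intros c K HK Hc N M HNM. eapply Rle_trans; [now apply (Zpartial_tail c K)|].
assert (0 < / INR (S M)) by (apply Rinv_0_lt_compat, lt_0_INR; lia). nra.
Qed.

Lemma Zseries_lim : forall c K, 0 <= K ->
  (forall n, Rabs (c n) <= K * / (1 + IZR n ^ 2)) ->
  is_lim_seq (Zpartial c) (real (Zseries c)).
Proof.
intros c K HK Hc. apply Lim_seq_correct', ex_lim_seq_cauchy_corr. intros eps.
destruct (inv_INR_small (eps / (4 * K + 1))) as [n0 Hn0].
{ apply Rdiv_lt_0_compat; [apply eps|lra]. }
assert (G : forall n m, (n0 <= n)%nat -> (n <= m)%nat ->
  Rabs (Zpartial c m - Zpartial c n) < eps).
{ intros n m Hn Hm. eapply Rle_lt_trans; [now apply (Zpartial_cauchy c K)|].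
  specialize (Hn0 n Hn).
  assert (0 < / INR (S n)) by (apply Rinv_0_lt_compat, lt_0_INR; lia).
  apply Rle_lt_trans with ((4 * K + 1) * / INR (S n)); [nra|].
  apply Rmult_lt_reg_l with (/ (4 * K + 1)); [apply Rinv_0_lt_compat; lra|].
  rewrite <- Rmult_assoc, Rinv_l, Rmult_1_l by lra. unfold Rdiv in Hn0; lra. }
exists n0. intros n m Hn Hm. destruct (Nat.le_ge_cases n m) as [h|h].
- rewrite Rabs_minus_sym. now apply G.
- now apply G.
Qed.

Lemma Zseries_tail : forall c K, 0 <= K ->
  (forall n, Rabs (c n) <= K * / (1 + IZR n ^ 2)) ->
  forall N, Rabs (real (Zseries c) - Zpartial c N) <= 4 * K * / INR (S N).
Proof.
intros c K HK Hc N.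
assert (L := Zseries_lim c K HK Hc).
assert (L2 : is_lim_seq (fun n => Rabs (Zpartial c n - Zpartial c N)) (Rabs (real (Zseries c) - Zpartial c N))).
{ apply (is_lim_seq_abs _ (Finite (real (Zseries c) - Zpartial c N))).
  apply is_lim_seq_minus'; [exact L|apply is_lim_seq_const]. }
apply (is_lim_seq_le_loc _ (fun _ => 4 * K * / INR (S N)) (Finite _) (Finite _))
  with (2 := L2).
- exists N. intros n Hn. now apply Zpartial_cauchy.
- apply is_lim_seq_const.
Qed.

Lemma Zseries_bound : forall c K, 0 <= K ->
  (forall n, Rabs (c n) <= K * / (1 + IZR n ^ 2)) ->
  Rabs (real (Zseries c)) <= 5 * K.
Proof.
intros c K HK Hc. assert (T := Zseries_tail c K HK Hc 0).
simpl Zpartial in T. simpl INR in T.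
assert (H := Hc 0%Z).
replace (K * / (1 + IZR 0 ^ 2)) with K in H by (simpl; field).
rewrite Rinv_1 in T.
replace (real (Zseries c)) with ((real (Zseries c) - c 0%Z) + c 0%Z) by ring.
eapply Rle_trans; [apply Rabs_triang|]. lra.
Qed.

Lemma Zpartial_ext_le : forall c d N, (forall n, (Z.abs_nat n <= N)%nat -> c n = d n) ->
  Zpartial c N = Zpartial d N.
Proof.
intros c d N H; induction N as [|N IH]; cbn [Zpartial]; [apply H; simpl; lia|].
rewrite IH, !H; auto; try lia.
Qed.

Lemma Zpartial_pick0 : forall c N, (forall j, j <> 0%Z -> c j = 0) -> Zpartial c N = c 0%Z.
Proof.
intros c N H; induction N as [|N IH]; cbn [Zpartial]; [reflexivity|].
rewrite IH, (H (Z.of_nat (S N))), (H (- Z.of_nat (S N))%Z) by lia. ring.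
Qed.

Lemma Zpartial_pick : forall c n N, n <> 0%Z ->
  (forall j, j <> n -> j <> (- n)%Z -> c j = 0) -> (Z.abs_nat n <= N)%nat ->
  Zpartial c N = c n + c (- n)%Z.
Proof.
intros c n N Hn H.
assert (Z0 : forall N, (N < Z.abs_nat n)%nat -> Zpartial c N = 0).
{ induction N0 as [|N0 IH]; intros HN; cbn [Zpartial].
  - apply H; lia.
  - rewrite IH, !H by lia. ring. }
induction N as [|N IH]; intros HN; [lia|]. cbn [Zpartial].
destruct (Nat.eq_dec (Z.abs_nat n) (S N)) as [E|E].
- rewrite Z0 by lia. destruct (Z_le_gt_dec 0 n).
  + replace (Z.of_nat (S N)) with n by lia. ring.
  + replace (Z.of_nat (S N)) with (- n)%Z by lia. rewrite Z.opp_involutive. ring.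
- rewrite IH by lia. rewrite (H (Z.of_nat (S N))), (H (- Z.of_nat (S N))%Z) by lia. ring.
Qed.

(** * Fourier coefficients *)

Definition cos_coef (f : R -> R) (n : Z) : R :=
  / (2 * PI) * integral (fun x => f x * cos (IZR n * x)).
Definition sin_coef (f : R -> R) (n : Z) : R :=
  / (2 * PI) * integral (fun x => f x * sin (IZR n * x)).

Definition cosn (n : Z) (x : R) := cos (IZR n * x).
Definition sinn (n : Z) (x : R) := sin (IZR n * x).

Lemma periodic_cosn : forall n, periodic (cosn n) /\ periodic (sinn n).
Proof.
assert (P : forall n : nat, periodic (cosn (Z.of_nat n)) /\ periodic (sinn (Z.of_nat n))).
{ intros n. split; intros x; unfold cosn, sinn; rewrite <- INR_IZR_INZ, Rmult_plus_distr_l.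
  - replace (INR n * (2 * PI)) with (2 * INR n * PI) by ring. apply cos_period.
  - replace (INR n * (2 * PI)) with (2 * INR n * PI) by ring. apply sin_period. }
intros n. destruct (Z_le_gt_dec 0 n) as [h|h].
- rewrite <- (Z2Nat.id n h). apply P.
- destruct (P (Z.to_nat (- n))) as [P1 P2]. rewrite Z2Nat.id in P1, P2 by lia.
  unfold cosn, sinn in *; rewrite opp_IZR in P1, P2.
  split; intros x; [specialize (P1 x)|specialize (P2 x)]; cbv beta in *.
  + now rewrite !Ropp_mult_distr_l_reverse, !cos_neg in P1.
  + rewrite !Ropp_mult_distr_l_reverse, !sin_neg in P2. lra.
Qed.

Lemma smooth_cosn : forall n, smooth_circle (cosn n).
Proof.
intros n; apply smooth_Ck; split; [apply periodic_cosn|]. intros k.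
replace (cosn n) with (fun x => 1 * cos (IZR n * x) + 0 * sin (IZR n * x)); [apply Ck_trig|].
apply functional_extensionality; intros x; unfold cosn; ring.
Qed.

Lemma smooth_sinn : forall n, smooth_circle (sinn n).
Proof.
intros n; apply smooth_Ck; split; [apply periodic_cosn|]. intros k.
replace (sinn n) with (fun x => 0 * cos (IZR n * x) + 1 * sin (IZR n * x)); [apply Ck_trig|].
apply functional_extensionality; intros x; unfold sinn; ring.
Qed.

Lemma Derive_cosn : forall n, Derive (cosn n) = fun x => - IZR n * sinn n x.
Proof.
intros n; apply functional_extensionality; intros x; apply is_derive_unique.
unfold cosn, sinn; auto_derive; auto. ring.
Qed.

Lemma Derive_sinn : forall n, Derive (sinn n) = fun x => IZR n * cosn n x.
Proof.
intros n; apply functional_extensionality; intros x; apply is_derive_unique.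
unfold cosn, sinn; auto_derive; auto. ring.
Qed.

Lemma cos_coef_Derive : forall f n, smooth_circle f ->
  cos_coef (Derive f) n = IZR n * sin_coef f n.
Proof.
intros f n Hf. unfold cos_coef, sin_coef.
change (fun x => Derive f x * cos (IZR n * x)) with (fun x => Derive f x * cosn n x).
rewrite int_parts, Derive_cosn by auto using smooth_cosn.
replace (fun x => f x * (- IZR n * sinn n x)) with (fun x => - IZR n * (f x * sin (IZR n * x)))
  by (apply functional_extensionality; intros; unfold sinn; ring).
rewrite int_scal; [ring|]. apply (smooth_ex_int (fun x => f x * sinn n x)), smooth_mult;
  auto using smooth_sinn.
Qed.

Lemma sin_coef_Derive : forall f n, smooth_circle f ->
  sin_coef (Derive f) n = - IZR n * cos_coef f n.
Proof.
intros f n Hf. unfold cos_coef, sin_coef.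
change (fun x => Derive f x * sin (IZR n * x)) with (fun x => Derive f x * sinn n x).
rewrite int_parts, Derive_sinn by auto using smooth_sinn.
replace (fun x => f x * (IZR n * cosn n x)) with (fun x => IZR n * (f x * cos (IZR n * x)))
  by (apply functional_extensionality; intros; unfold cosn; ring).
rewrite int_scal; [ring|]. apply (smooth_ex_int (fun x => f x * cosn n x)), smooth_mult;
  auto using smooth_cosn.
Qed.

Lemma cont_mult : forall f g : R -> R, forall x, continuous f x -> continuous g x ->
  continuous (fun x => f x * g x) x.
Proof. intros f g x Hf Hg. exact (continuous_mult f g x Hf Hg). Qed.

(** The quotients in Dirichlet's argument below are continuous on the closed period but
    not periodic, and Bessel's inequality has to apply to them. *)
Definition continuous_on_period (f : R -> R) : Prop := forall x : R, 0 <= x <= 2 * PI ->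
  continuous f x.

Lemma smooth_continuous_on_period : forall f, smooth_circle f -> continuous_on_period f.
Proof. intros f Hf x _. now apply smooth_continuous. Qed.

Lemma continuous_on_period_integrable : forall f, continuous_on_period f -> integrable f.
Proof.
intros f Hf. apply (@ex_RInt_continuous R_CompleteNormedModule). intros x Hx.
rewrite Rmin_left, Rmax_right in Hx by (generalize two_PI_pos; lra). now apply Hf.
Qed.

Lemma continuous_on_period_mult : forall f g, continuous_on_period f ->
  continuous_on_period g -> continuous_on_period (fun x => f x * g x).
Proof. intros f g Hf Hg x Hx. apply cont_mult; auto. Qed.

Lemma continuous_on_period_plus : forall f g, continuous_on_period f ->
  continuous_on_period g -> continuous_on_period (fun x => f x + g x).
Proof. intros f g Hf Hg x Hx. apply (continuous_plus f g); auto. Qed.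

Lemma continuous_on_period_minus : forall f g, continuous_on_period f ->
  continuous_on_period g -> continuous_on_period (fun x => f x - g x).
Proof. intros f g Hf Hg x Hx. apply (continuous_minus f g); auto. Qed.

Lemma ex_int_mult_cosn : forall f n, continuous_on_period f ->
  integrable (fun x => f x * cos (IZR n * x)).
Proof.
intros f n Hf. apply (@ex_RInt_continuous R_CompleteNormedModule). intros x Hx.
rewrite Rmin_left, Rmax_right in Hx by (generalize two_PI_pos; lra).
apply cont_mult; [now apply Hf|]. apply (smooth_continuous (cosn n)), smooth_cosn.
Qed.

Lemma ex_int_mult_sinn : forall f n, continuous_on_period f ->
  integrable (fun x => f x * sin (IZR n * x)).
Proof.
intros f n Hf. apply (@ex_RInt_continuous R_CompleteNormedModule). intros x Hx.
rewrite Rmin_left, Rmax_right in Hx by (generalize two_PI_pos; lra).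
apply cont_mult; [now apply Hf|]. apply (smooth_continuous (sinn n)), smooth_sinn.
Qed.

Lemma cos_coef_opp : forall f n, cos_coef f (- n) = cos_coef f n.
Proof.
intros f n; unfold cos_coef; f_equal; apply int_ext; intros x.
now rewrite opp_IZR, Ropp_mult_distr_l_reverse, cos_neg.
Qed.

Lemma sin_coef_opp : forall f n, continuous_on_period f -> sin_coef f (- n) = - sin_coef f n.
Proof.
intros f n Hf; unfold sin_coef. rewrite <- Ropp_mult_distr_r_reverse; f_equal.
replace (- integral (fun x => f x * sin (IZR n * x)))
  with (-1 * integral (fun x => f x * sin (IZR n * x))) by ring.
rewrite <- int_scal by now apply ex_int_mult_sinn.
apply int_ext; intros x. rewrite opp_IZR, Ropp_mult_distr_l_reverse, sin_neg. ring.
Qed.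

Lemma coef_bound : forall f n B, continuous_on_period f ->
  (forall x, 0 <= x <= 2 * PI -> Rabs (f x) <= B) ->
  Rabs (cos_coef f n) <= B /\ Rabs (sin_coef f n) <= B.
Proof.
intros f n B Hf HB. assert (P := two_PI_pos).
assert (Q : forall g, integrable (fun x => f x * g x) -> (forall x, Rabs (g x) <= 1) ->
  Rabs (/ (2 * PI) * integral (fun x => f x * g x)) <= B).
{ intros g Hg1 Hg2. rewrite Rabs_mult, Rabs_pos_eq by (left; now apply Rinv_0_lt_compat).
  apply Rmult_le_reg_l with (2 * PI); [lra|].
  rewrite <- Rmult_assoc, Rinv_r, Rmult_1_l by lra.
  apply int_abs_bound; auto. intros x Hx. rewrite Rabs_mult.
  specialize (HB x Hx). specialize (Hg2 x). generalize (Rabs_pos (f x)) (Rabs_pos (g x)). nra.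
  }
split; apply Q.
- now apply ex_int_mult_cosn.
- intros x. apply Rabs_le, COS_bound.
- now apply ex_int_mult_sinn.
- intros x. apply Rabs_le, SIN_bound.
Qed.

(** Orthogonality from the eigenvalue equation: integrating by parts twice, the
    coefficients at n of a function with f'' = -j^2 f are multiplied both by -n^2 and
    by -j^2, hence vanish when n^2 and j^2 differ. *)
Lemma coef_trig_off_diagonal : forall j n, (j <> n)%Z -> (j <> - n)%Z ->
  cos_coef (cosn j) n = 0 /\ sin_coef (cosn j) n = 0 /\ cos_coef (sinn j) n = 0 /\
    sin_coef (sinn j) n = 0.
Proof.
intros j n H1 H2.
assert (Hn : IZR n ^ 2 - IZR j ^ 2 <> 0).
{ replace (IZR n ^ 2 - IZR j ^ 2) with ((IZR n - IZR j) * (IZR n + IZR j)) by ring.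
  rewrite <- minus_IZR, <- plus_IZR, <- mult_IZR. apply not_0_IZR. nia. }
assert (L : forall c f n, smooth_circle f ->
  cos_coef (fun x => c * f x) n = c * cos_coef f n /\
    sin_coef (fun x => c * f x) n = c * sin_coef f n).
{ intros c f m Hf. unfold cos_coef, sin_coef. split.
  - replace (fun x => c * f x * cos (IZR m * x)) with (fun x => c * (f x * cosn m x))
    by (apply functional_extensionality; intros; unfold cosn; ring).
    rewrite int_scal; [unfold cosn; ring|]. apply smooth_ex_int, smooth_mult;
      auto using smooth_cosn.
  - replace (fun x => c * f x * sin (IZR m * x)) with (fun x => c * (f x * sinn m x))
    by (apply functional_extensionality; intros; unfold sinn; ring).
    rewrite int_scal; [unfold sinn; ring|]. apply smooth_ex_int, smooth_mult;
      auto using smooth_sinn. }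
assert (C := smooth_cosn j). assert (S := smooth_sinn j).
assert (C1 := cos_coef_Derive _ n C). assert (C2 := sin_coef_Derive _ n C).
assert (S1 := cos_coef_Derive _ n S). assert (S2 := sin_coef_Derive _ n S).
rewrite Derive_cosn in C1, C2. rewrite Derive_sinn in S1, S2.
rewrite (proj1 (L _ _ n S)) in C1. rewrite (proj2 (L _ _ n S)) in C2.
rewrite (proj1 (L _ _ n C)) in S1. rewrite (proj2 (L _ _ n C)) in S2.
repeat split; apply Rmult_eq_reg_l with (IZR n ^ 2 - IZR j ^ 2); auto; rewrite Rmult_0_r.
- replace ((IZR n ^ 2 - IZR j ^ 2) * cos_coef (cosn j) n)
  with (- (IZR n * (- IZR n * cos_coef (cosn j) n)) - IZR j * (IZR j * cos_coef (cosn j) n))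
    by ring.
  rewrite <- C2, S1. ring.
- replace ((IZR n ^ 2 - IZR j ^ 2) * sin_coef (cosn j) n)
  with (IZR n * (IZR n * sin_coef (cosn j) n) - IZR j * (IZR j * sin_coef (cosn j) n)) by ring.
  rewrite <- C1, S2. ring.
- replace ((IZR n ^ 2 - IZR j ^ 2) * cos_coef (sinn j) n)
  with (- (IZR n * (- IZR n * cos_coef (sinn j) n)) + IZR j * (- IZR j * cos_coef (sinn j) n))
    by ring.
  rewrite <- S2, C1. ring.
- replace ((IZR n ^ 2 - IZR j ^ 2) * sin_coef (sinn j) n)
  with (IZR n * (IZR n * sin_coef (sinn j) n) + IZR j * (- IZR j * sin_coef (sinn j) n))
    by ring.
  rewrite <- S1, C2. ring.
Qed.

(** The squares of cosine and sine have equal integrals, by parts, and add up to 1. *)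
Lemma coef_trig_diagonal : forall n, (n <> 0)%Z ->
  cos_coef (cosn n) n = / 2 /\ sin_coef (cosn n) n = 0 /\ cos_coef (sinn n) n = 0 /\
    sin_coef (sinn n) n = / 2.
Proof.
intros n Hn. assert (Hn' : IZR n <> 0) by now apply not_0_IZR.
assert (P := two_PI_pos).
assert (C := smooth_cosn n). assert (S := smooth_sinn n).
assert (E1 : integral (fun x => cosn n x * cosn n x) + integral (fun x => sinn n x * sinn n x)
  = 2 * PI).
{ rewrite <- int_plus by (apply smooth_ex_int, smooth_mult; auto).
  replace (2 * PI) with (2 * PI * 1) by ring. rewrite <- int_const. apply int_ext. intros x.
  generalize (sin2_cos2 (IZR n * x)). unfold Rsqr, cosn, sinn. lra. }
assert (E2 : integral (fun x => cosn n x * cosn n x)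
  = integral (fun x => sinn n x * sinn n x)).
{ assert (H := int_parts _ _ S C). rewrite Derive_sinn, Derive_cosn in H.
  replace (fun x => IZR n * cosn n x * cosn n x)
    with (fun x => IZR n * (cosn n x * cosn n x)) in H by (apply functional_extensionality;
      intros; ring).
  replace (fun x => sinn n x * (- IZR n * sinn n x))
    with (fun x => - IZR n * (sinn n x * sinn n x)) in H by (apply functional_extensionality;
      intros; ring).
  rewrite !int_scal in H by (apply smooth_ex_int, smooth_mult; auto).
  apply Rmult_eq_reg_l with (IZR n); auto. lra. }
assert (E3 : integral (fun x => cosn n x * sinn n x) = 0).
{ assert (H := int_parts _ _ S S). rewrite Derive_sinn in H.
  replace (fun x => IZR n * cosn n x * sinn n x)
    with (fun x => IZR n * (cosn n x * sinn n x)) in H by (apply functional_extensionality;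
      intros; ring).
  replace (fun x => sinn n x * (IZR n * cosn n x))
    with (fun x => IZR n * (cosn n x * sinn n x)) in H by (apply functional_extensionality;
      intros; ring).
  rewrite !int_scal in H by (apply smooth_ex_int, smooth_mult; auto).
  apply Rmult_eq_reg_l with (IZR n); auto. lra. }
unfold cos_coef, sin_coef.
change (fun x => cosn n x * cos (IZR n * x)) with (fun x => cosn n x * cosn n x).
change (fun x => cosn n x * sin (IZR n * x)) with (fun x => cosn n x * sinn n x).
change (fun x => sinn n x * sin (IZR n * x)) with (fun x => sinn n x * sinn n x).
replace (fun x => sinn n x * cos (IZR n * x)) with (fun x => cosn n x * sinn n x)
  by (apply functional_extensionality; intros; unfold cosn; ring).
rewrite E3. repeat split; try ring.
- replace (integral (fun x => cosn n x * cosn n x)) with PI by lra. field;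
  generalize PI_RGT_0; lra.
- replace (integral (fun x => sinn n x * sinn n x)) with PI by lra. field;
  generalize PI_RGT_0; lra.
Qed.

(** * Fourier multipliers *)

(** The real part of the n-th term of the multiplier series. For an even symbol w the
    terms of index n and -n are conjugate, so the real parts have the same sum. *)
Definition multiplier_term (w : Z -> R) (f : R -> R) (x : R) (n : Z) : R :=
  w n * (cos_coef f n * cosn n x + sin_coef f n * sinn n x).
Definition multiplier_partial (w : Z -> R) (f : R -> R) (N : nat) (x : R) : R :=
  Zpartial (multiplier_term w f x) N.
Definition multiplier (w : Z -> R) (f : R -> R) (x : R) : R :=
  real (Zseries (multiplier_term w f x)).

Lemma smooth_multiplier_term : forall w f n, smooth_circle (fun x => multiplier_term w f x n).
Proof.
intros w f n. unfold multiplier_term. apply smooth_scal, smooth_plus; apply smooth_scal;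
auto using smooth_cosn, smooth_sinn.
Qed.

Lemma smooth_multiplier_partial : forall w f N, smooth_circle (multiplier_partial w f N).
Proof.
intros w f N. unfold multiplier_partial. induction N as [|N IH]; cbn [Zpartial].
- apply smooth_multiplier_term.
- apply smooth_plus; [exact IH|]. apply smooth_plus; apply smooth_multiplier_term.
Qed.

Lemma Derive_multiplier_term : forall w f n x, smooth_circle f ->
  Derive (fun x => multiplier_term w f x n) x = multiplier_term w (Derive f) x n.
Proof.
intros w f n x Hf. unfold multiplier_term.
rewrite cos_coef_Derive, sin_coef_Derive by assumption.
apply is_derive_unique. unfold cosn, sinn. auto_derive; auto. ring.
Qed.

Lemma Derive_multiplier_partial : forall w f N x, smooth_circle f ->
  Derive (multiplier_partial w f N) x = multiplier_partial w (Derive f) N x.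
Proof.
intros w f N x Hf. unfold multiplier_partial. revert x; induction N as [|N IH]; intros x;
  cbn [Zpartial].
- now apply Derive_multiplier_term.
- rewrite Derive_plus; [rewrite IH;
  f_equal|apply (smooth_ex_derive (multiplier_partial w f N)), smooth_multiplier_partial|].
  + rewrite Derive_plus by apply smooth_ex_derive, smooth_multiplier_term.
    now rewrite !Derive_multiplier_term.
  + apply (smooth_ex_derive (fun x => _ + _)), smooth_plus; apply smooth_multiplier_term.
Qed.

Lemma integral_multiplier_partial : forall w f g N, continuous_on_period g ->
  / (2 * PI) * integral (fun x => multiplier_partial w f N x * g x) =
  Zpartial (fun j => w j * (cos_coef f j * cos_coef g j + sin_coef f j * sin_coef g j)) N.
Proof.
intros w f g N Hg.
assert (T : forall j, / (2 * PI) * integral (fun x => multiplier_term w f x j * g x) =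
   w j * (cos_coef f j * cos_coef g j + sin_coef f j * sin_coef g j)).
{ intros j. unfold multiplier_term.
  replace (fun x => w j * (cos_coef f j * cosn j x + sin_coef f j * sinn j x) * g x) with
    (fun x => (w j * cos_coef f j) * (g x * cosn j x) + (w j * sin_coef f j) * (g x * sinn j
      x))
    by (apply functional_extensionality; intros; ring).
  assert (C : continuous_on_period (fun x => g x * cosn j x))
    by (apply continuous_on_period_mult; auto using smooth_continuous_on_period, smooth_cosn).
  assert (S : continuous_on_period (fun x => g x * sinn j x))
    by (apply continuous_on_period_mult; auto using smooth_continuous_on_period, smooth_sinn).
  rewrite int_plus, !int_scal; auto using continuous_on_period_integrable.
  - change (cos_coef g j) with (/ (2 * PI) * integral (fun x => g x * cosn j x)).
    change (sin_coef g j) with (/ (2 * PI) * integral (fun x => g x * sinn j x)). ring.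
  - apply continuous_on_period_integrable, continuous_on_period_mult;
    auto. apply smooth_continuous_on_period, smooth_const.
  - apply continuous_on_period_integrable, continuous_on_period_mult;
    auto. apply smooth_continuous_on_period, smooth_const. }
assert (W : forall j, integrable (fun x => multiplier_term w f x j * g x)).
{ intros j. apply continuous_on_period_integrable, continuous_on_period_mult;
  auto. apply smooth_continuous_on_period, smooth_multiplier_term. }
unfold multiplier_partial. induction N as [|N IH]; cbn [Zpartial]; [apply T|].
rewrite <- IH, <- !T, <- !Rmult_plus_distr_l. f_equal.
rewrite <- !int_plus; auto.
- apply int_ext; intros; ring.
- apply continuous_on_period_integrable, continuous_on_period_mult;
  auto. apply smooth_continuous_on_period, (smooth_multiplier_partial w f N).
- apply (ex_RInt_plus (V := R_NormedModule)); apply W.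
Qed.

Lemma coef_multiplier_partial : forall w f N n, continuous_on_period f ->
  (forall n, w (- n)%Z = w n) ->
  (Z.abs_nat n <= N)%nat ->
  cos_coef (multiplier_partial w f N) n = w n * cos_coef f n /\
    sin_coef (multiplier_partial w f N) n = w n * sin_coef f n.
Proof.
intros w f N n Hf Hw HN.
unfold cos_coef at 1. unfold sin_coef at 1.
assert (E1 := integral_multiplier_partial w f (cosn n) N (smooth_continuous_on_period _
  (smooth_cosn n))).
assert (E2 := integral_multiplier_partial w f (sinn n) N (smooth_continuous_on_period _
  (smooth_sinn n))).
change (fun x => multiplier_partial w f N x * cos (IZR n * x))
  with (fun x => multiplier_partial w f N x * cosn n x).
change (fun x => multiplier_partial w f N x * sin (IZR n * x))
  with (fun x => multiplier_partial w f N x * sinn n x).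
rewrite E1, E2. clear E1 E2.
assert (Off : forall j, j <> n -> j <> (- n)%Z ->
  cos_coef (cosn n) j = 0 /\ sin_coef (cosn n) j = 0 /\ cos_coef (sinn n) j = 0 /\
    sin_coef (sinn n) j = 0).
{ intros j H1 H2. apply coef_trig_off_diagonal; lia. }
destruct (Z.eq_dec n 0) as [->|Hn].
- assert (C0 : cosn 0 = fun _ => 1) by (apply functional_extensionality; intros; unfold cosn;
  now rewrite Rmult_0_l, cos_0).
  assert (S0 : sinn 0 = fun _ => 0) by (apply functional_extensionality; intros; unfold sinn;
    now rewrite Rmult_0_l, sin_0).
  assert (Z : forall h, sin_coef h 0 = 0).
  { intros h. unfold sin_coef. change (fun x => h x * sin (0 * x))
    with (fun x => h x * sinn 0 x).
    rewrite S0. replace (fun x => h x * 0) with (fun _ : R => 0)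
      by (apply functional_extensionality; intros; ring).
    rewrite int_const. ring. }
  rewrite !Zpartial_pick0.
  + rewrite !Z. assert (Z' : cos_coef (sinn 0) 0 = 0).
    { unfold cos_coef. change (fun x => sinn 0 x * cos (0 * x))
      with (fun x => sinn 0 x * cosn 0 x).
      rewrite S0. replace (fun x => 0 * cosn 0 x) with (fun _ : R => 0)
        by (apply functional_extensionality; intros; ring).
      rewrite int_const. ring. }
    rewrite Z'. split; [|ring].
    replace (cos_coef (cosn 0) 0) with 1; [ring|]. unfold cos_coef.
    change (fun x => cosn 0 x * cos (0 * x)) with (fun x => cosn 0 x * cosn 0 x).
    rewrite C0. replace (fun _ : R => 1 * 1) with (fun _ : R => 1)
      by (apply functional_extensionality; intros; ring).
    rewrite int_const. field. generalize PI_RGT_0; lra.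
  + intros j Hj. destruct (Off j) as [_ [_ [H3 H4]]]; [lia|lia|]. rewrite H3, H4; ring.
  + intros j Hj. destruct (Off j) as [H1 [H2 _]]; [lia|lia|]. rewrite H1, H2; ring.
- rewrite !(Zpartial_pick _ n) by (auto; intros j H1 H2;
  destruct (Off j H1 H2) as [e1 [e2 [e3 e4]]]; rewrite ?e1, ?e2, ?e3, ?e4; ring).
  destruct (coef_trig_diagonal n Hn) as [D1 [D2 [D3 D4]]].
  rewrite !Hw, !cos_coef_opp, !sin_coef_opp, D1, D2, D3, D4;
    auto using smooth_continuous_on_period, smooth_cosn, smooth_sinn.
  split; field.
Qed.

(** The partial sum S of f satisfies int f S = int S^2, because both sides only see
    the coefficients of index at most N; so int (f - S)^2 >= 0 is the inequality. *)
Lemma Bessel : forall f N, continuous_on_period f ->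
  2 * PI * Zpartial (fun n => cos_coef f n ^ 2 + sin_coef f n ^ 2) N <= L2sq f.
Proof.
intros f N Hf. set (S := multiplier_partial (fun _ => 1) f N).
assert (HS : smooth_circle S) by apply smooth_multiplier_partial.
assert (HSc := smooth_continuous_on_period _ HS). assert (P := two_PI_pos).
set (Z := Zpartial (fun n => cos_coef f n ^ 2 + sin_coef f n ^ 2) N).
assert (E1 : integral (fun x => S x * f x) = 2 * PI * Z).
{ apply Rmult_eq_reg_l with (/ (2 * PI)); [|apply Rinv_neq_0_compat; lra].
  rewrite (integral_multiplier_partial (fun _ => 1) f f N Hf : _ * integral (fun x => S x * f
    x) = _), <- Rmult_assoc, Rinv_l, Rmult_1_l by lra.
  apply Zpartial_ext; intros; ring. }
assert (E2 : integral (fun x => S x * S x) = 2 * PI * Z).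
{ apply Rmult_eq_reg_l with (/ (2 * PI)); [|apply Rinv_neq_0_compat; lra].
  rewrite (integral_multiplier_partial (fun _ => 1) f S N HSc : _ * integral (fun x => S x * S
    x) = _), <- Rmult_assoc, Rinv_l, Rmult_1_l by lra.
  apply Zpartial_ext_le; intros n Hn. unfold S.
  destruct (coef_multiplier_partial (fun _ => 1) f N n Hf (fun _ => eq_refl) Hn) as [e1 e2].
  rewrite e1, e2. ring. }
assert (H : 0 <= integral (fun x => (f x - S x) * (f x - S x))).
{ replace 0 with (integral (fun _ => 0)) by (rewrite int_const; ring).
  apply int_le; [apply smooth_ex_int, smooth_const| |intros x; apply Rle_0_sqr].
  apply continuous_on_period_integrable, continuous_on_period_mult;
    now apply continuous_on_period_minus. }
replace (fun x => (f x - S x) * (f x - S x))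
  with (fun x => (f x * f x + S x * S x) - 2 * (S x * f x)) in H
  by (apply functional_extensionality; intros; ring).
assert (Hff : continuous_on_period (fun x => f x * f x))
  by now apply continuous_on_period_mult.
assert (HSS : continuous_on_period (fun x => S x * S x))
  by now apply continuous_on_period_mult.
assert (HSf : continuous_on_period (fun x => S x * f x))
  by now apply continuous_on_period_mult.
rewrite int_minus, int_plus, int_scal, E1, E2 in H;
  auto using continuous_on_period_integrable, continuous_on_period_plus.
- unfold L2sq. replace (fun x => f x ^ 2) with (fun x => f x * f x)
  by (apply functional_extensionality; intros; ring).
  lra.
- apply continuous_on_period_integrable, continuous_on_period_mult;
  auto. apply smooth_continuous_on_period, smooth_const.
Qed.

(** The operator 1 - D^2. Its powers have the symbols (1+n^2)^p, so sup bounds on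
    them give decay of the Fourier coefficients without separating n = 0. *)
Definition Helmholtz (f : R -> R) (x : R) : R := f x - Derive_n f 2 x.

Lemma smooth_Helmholtz : forall f, smooth_circle f -> smooth_circle (Helmholtz f).
Proof. intros f Hf. unfold Helmholtz. apply smooth_minus;
  [exact Hf|now apply (smooth_Derive_n f 2)]. Qed.

Fixpoint Helmholtz_pow (p : nat) (f : R -> R) : R -> R :=
  match p with O => f | S p => Helmholtz_pow p (Helmholtz f) end.

Lemma smooth_Helmholtz_pow : forall p f, smooth_circle f -> smooth_circle (Helmholtz_pow p f).
Proof. induction p; intros f Hf; simpl; auto using smooth_Helmholtz. Qed.

Lemma coef_minus : forall f g n, continuous_on_period f -> continuous_on_period g ->
  cos_coef (fun x => f x - g x) n = cos_coef f n - cos_coef g n /\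
    sin_coef (fun x => f x - g x) n = sin_coef f n - sin_coef g n.
Proof.
intros f g n Hf Hg. unfold cos_coef, sin_coef. split.
- rewrite <- Rmult_minus_distr_l, <- int_minus by now apply ex_int_mult_cosn.
  f_equal; apply int_ext; intros; ring.
- rewrite <- Rmult_minus_distr_l, <- int_minus by now apply ex_int_mult_sinn.
  f_equal; apply int_ext; intros; ring.
Qed.

Lemma coef_scal : forall c f n, continuous_on_period f ->
  cos_coef (fun x => c * f x) n = c * cos_coef f n /\
    sin_coef (fun x => c * f x) n = c * sin_coef f n.
Proof.
intros c f n Hf. unfold cos_coef, sin_coef. split.
- replace (fun x => c * f x * cos (IZR n * x)) with (fun x => c * (f x * cos (IZR n * x)))
  by (apply functional_extensionality; intros; ring).
  rewrite int_scal by now apply ex_int_mult_cosn. ring.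
- replace (fun x => c * f x * sin (IZR n * x)) with (fun x => c * (f x * sin (IZR n * x)))
  by (apply functional_extensionality; intros; ring).
  rewrite int_scal by now apply ex_int_mult_sinn. ring.
Qed.

Lemma coef_Derive2 : forall f n, smooth_circle f ->
  cos_coef (Derive_n f 2) n = - IZR n ^ 2 * cos_coef f n /\
    sin_coef (Derive_n f 2) n = - IZR n ^ 2 * sin_coef f n.
Proof.
intros f n Hf. rewrite !Derive_n_S_fun. cbn [Derive_n].
change (fun x => Derive (Derive f) x) with (Derive (Derive f)).
assert (Hf' := smooth_Derive _ Hf).
split.
- rewrite cos_coef_Derive, sin_coef_Derive by assumption. ring.
- rewrite sin_coef_Derive, cos_coef_Derive by assumption. ring.
Qed.

Lemma coef_Helmholtz_pow : forall p f n, smooth_circle f ->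
  cos_coef (Helmholtz_pow p f) n = (1 + IZR n ^ 2) ^ p * cos_coef f n /\
  sin_coef (Helmholtz_pow p f) n = (1 + IZR n ^ 2) ^ p * sin_coef f n.
Proof.
induction p as [|p IH]; intros f n Hf; simpl Helmholtz_pow.
- simpl; split; ring.
- destruct (IH (Helmholtz f) n (smooth_Helmholtz _ Hf)) as [-> ->]. unfold Helmholtz.
  destruct (coef_minus f (Derive_n f 2) n) as [-> ->];
    auto using smooth_continuous_on_period, smooth_Derive_n.
  destruct (coef_Derive2 f n Hf) as [-> ->]. simpl. split; ring.
Qed.

(** Growth is measured by the symbol of a power of 1 - D^2: one power more makes the
    multiplier series of a smooth function converge. *)
Definition admissible (w : Z -> R) (q : nat) : Prop :=
  (forall n, Rabs (w n) <= (1 + IZR n ^ 2) ^ q) /\ (forall n, w (- n)%Z = w n).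

(** Moving q + 1 powers of 1 - D^2 onto f compensates the growth of w and leaves the
    summable factor 1/(1+n^2). *)
Lemma multiplier_term_bound : forall w q f B x, admissible w q -> smooth_circle f ->
  (forall y, Rabs (Helmholtz_pow (S q) f y) <= B) ->
  forall n, Rabs (multiplier_term w f x n) <= 2 * B * / (1 + IZR n ^ 2).
Proof.
intros w q f B x [Hw _] Hf HB n.
destruct (coef_bound (Helmholtz_pow (S q) f) n B) as [C1 C2]; auto.
{ now apply smooth_continuous_on_period, smooth_Helmholtz_pow. }
destruct (coef_Helmholtz_pow (S q) f n Hf) as [E1 E2]. rewrite E1 in C1. rewrite E2 in C2.
clear E1 E2.
assert (P : 0 < 1 + IZR n ^ 2) by (generalize (pow2_ge_0 (IZR n)); lra).
set (r := 1 + IZR n ^ 2) in *.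
assert (Pq : 0 < r ^ q) by now apply pow_lt.
assert (G : forall z, Rabs (r ^ S q * z) <= B -> Rabs (w n * z) <= B * / r).
{ intros z Hz. rewrite Rabs_mult. rewrite Rabs_mult, Rabs_pos_eq in Hz by (left;
  now apply pow_lt).
  apply Rle_trans with (r ^ q * Rabs z).
  - apply Rmult_le_compat_r; [apply Rabs_pos|]. apply Hw.
  - apply Rmult_le_reg_l with r; auto. replace (r * (B * / r)) with B by (field; lra).
    simpl in Hz. lra. }
apply G in C1. apply G in C2. unfold multiplier_term.
replace (w n * (cos_coef f n * cosn n x + sin_coef f n * sinn n x)) with
  (w n * cos_coef f n * cosn n x + w n * sin_coef f n * sinn n x) by ring.
eapply Rle_trans; [apply Rabs_triang|]. rewrite !(Rabs_mult (w n * _)).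
assert (Rabs (cosn n x) <= 1) by apply Rabs_le, COS_bound.
assert (Rabs (sinn n x) <= 1) by apply Rabs_le, SIN_bound.
generalize (Rabs_pos (w n * cos_coef f n)) (Rabs_pos (w n * sin_coef f n)) (Rabs_pos (cosn n
  x)) (Rabs_pos (sinn n x)).
intros. nra.
Qed.

Lemma Helmholtz_pow_bounded : forall q f, smooth_circle f ->
  exists B, 0 <= B /\ forall y, Rabs (Helmholtz_pow q f y) <= B.
Proof.
intros q f Hf. destruct (smooth_bounded _ (smooth_Helmholtz_pow q f Hf)) as [B HB].
exists B; split; auto. eapply Rle_trans; [apply Rabs_pos|apply (HB 0)].
Qed.

Lemma multiplier_tail : forall w q f, admissible w q -> smooth_circle f ->
  exists K, 0 <= K /\ forall N x, Rabs (multiplier w f x - multiplier_partial w f N x)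
    <= K * / INR (S N).
Proof.
intros w q f Hw Hf. destruct (Helmholtz_pow_bounded (S q) f Hf) as [B [HB0 HB]].
exists (4 * (2 * B)). split; [lra|]. intros N x.
apply Zseries_tail; [lra|]. now apply multiplier_term_bound with q.
Qed.

Lemma multiplier_bound : forall w q f B, admissible w q -> smooth_circle f ->
  (forall y, Rabs (Helmholtz_pow (S q) f y) <= B) ->
  forall x, Rabs (multiplier w f x) <= 10 * B.
Proof.
intros w q f B Hw Hf HB x. replace (10 * B) with (5 * (2 * B)) by ring.
apply Zseries_bound.
- specialize (HB 0). generalize (Rabs_pos (Helmholtz_pow (S q) f 0)); lra.
- now apply multiplier_term_bound with q.
Qed.

(** Termwise differentiation: the derivatives of the partial sums are the partial sums
    for f', and these converge uniformly too because f' is smooth. *)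
Lemma multiplier_derive : forall w q f x, admissible w q -> smooth_circle f ->
  is_derive (multiplier w f) x (multiplier w (Derive f) x).
Proof.
intros w q f x Hw Hf.
assert (CV : forall f, smooth_circle f ->
  CVU_dom (fun N x => multiplier_partial w f N x) (fun _ => True)).
{ intros g Hg eps. destruct (multiplier_tail w q g Hw Hg) as [K [HK0 HK]].
  destruct (inv_INR_small (eps / (K + 1))) as [N0 HN0].
  { apply Rdiv_lt_0_compat; [apply eps|lra]. }
  exists N0. intros n Hn y _. rewrite Rabs_minus_sym.
  eapply Rle_lt_trans; [apply HK|]. specialize (HN0 n Hn).
  assert (0 < / INR (S n)) by (apply Rinv_0_lt_compat, lt_0_INR; lia).
  apply Rle_lt_trans with ((K + 1) * / INR (S n)); [nra|].
  apply Rmult_lt_reg_l with (/ (K + 1)); [apply Rinv_0_lt_compat; lra|].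
  rewrite <- Rmult_assoc, Rinv_l, Rmult_1_l by lra. unfold Rdiv in HN0; lra. }
assert (E : multiplier w (Derive f) x
  = real (Lim_seq (fun n => Derive (multiplier_partial w f n) x))).
{ unfold multiplier, Zseries. f_equal. apply Lim_seq_ext. intros n.
now rewrite Derive_multiplier_partial. }
rewrite E.
apply (CVU_Derive (fun N x => multiplier_partial w f N x) (fun _ => True)); auto.
- apply open_true.
- now intros a b c.
- intros n y _. apply smooth_ex_derive, smooth_multiplier_partial.
- intros n y _. apply continuity_pt_filterlim.
  apply (smooth_continuous (Derive (multiplier_partial w f n))), smooth_Derive,
    smooth_multiplier_partial.
- assert (F : (fun (n : nat) x => Derive (multiplier_partial w f n) x)
  = fun n x => multiplier_partial w (Derive f) n x).
  { apply functional_extensionality; intros n. apply functional_extensionality;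
    intros y. now apply Derive_multiplier_partial. }
  change (CVU_dom (fun (n : nat) x => Derive (multiplier_partial w f n) x) (fun _ => True)).
  rewrite F. apply CV. now apply smooth_Derive.
Qed.

Lemma Derive_multiplier : forall w q f, admissible w q -> smooth_circle f ->
  Derive (multiplier w f) = multiplier w (Derive f).
Proof.
intros w q f Hw Hf. apply functional_extensionality; intros x.
apply is_derive_unique. now apply multiplier_derive with q.
Qed.

Lemma Derive_n_multiplier : forall w q f n, admissible w q -> smooth_circle f ->
  Derive_n (multiplier w f) n = multiplier w (Derive_n f n).
Proof.
intros w q f n Hw Hf. induction n as [|n IH]; [reflexivity|].
change (Derive (Derive_n (multiplier w f) n) = multiplier w (Derive (Derive_n f n))).
rewrite IH. apply Derive_multiplier with q; auto using smooth_Derive_n.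
Qed.

Lemma smooth_multiplier : forall w q f, admissible w q -> smooth_circle f ->
  smooth_circle (multiplier w f).
Proof.
intros w q f Hw Hf. split.
- intros x. unfold multiplier. do 2 f_equal. apply functional_extensionality; intros n.
  unfold multiplier_term. destruct (periodic_cosn n) as [P1 P2]. now rewrite P1, P2.
- intros [|n] x; [exact Logic.I|]. cbn [ex_derive_n].
  rewrite (Derive_n_multiplier w q f n Hw Hf).
  eexists. apply multiplier_derive with q; auto using smooth_Derive_n.
Qed.

Lemma multiplier_lim : forall w q f x, admissible w q -> smooth_circle f ->
  is_lim_seq (fun N => multiplier_partial w f N x) (multiplier w f x).
Proof.
intros w q f x Hw Hf. destruct (Helmholtz_pow_bounded (S q) f Hf) as [B [HB0 HB]].
apply (Zseries_lim _ (2 * B)); [lra|]. now apply multiplier_term_bound with q.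
Qed.

Lemma multiplier_minus : forall w q f g x, admissible w q -> smooth_circle f ->
  smooth_circle g ->
  multiplier w (fun x => f x - g x) x = multiplier w f x - multiplier w g x.
Proof.
intros w q f g x Hw Hf Hg.
assert (H : is_lim_seq (fun N => multiplier_partial w (fun x => f x - g x) N x) (multiplier w
  f x - multiplier w g x)).
{ apply is_lim_seq_ext with (fun N => multiplier_partial w f N x - multiplier_partial w g N x).
  - intros N. unfold multiplier_partial, Rminus.
    replace (- Zpartial (multiplier_term w g x) N)
      with (-1 * Zpartial (multiplier_term w g x) N) by ring.
    rewrite <- Zpartial_scal, <- Zpartial_plus. apply Zpartial_ext. intros n.
    unfold multiplier_term. destruct (coef_minus f g n) as [E1 E2];
      auto using smooth_continuous_on_period.
    unfold Rminus in E1, E2. rewrite E1, E2. ring.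
  - apply is_lim_seq_minus'; now apply multiplier_lim with q. }
assert (H2 := multiplier_lim w q _ x Hw (smooth_minus _ _ Hf Hg)).
apply is_lim_seq_unique in H. apply is_lim_seq_unique in H2. rewrite H in H2. now inversion H2.
Qed.

Lemma multiplier_scal : forall w q c f x, admissible w q -> smooth_circle f ->
  multiplier w (fun x => c * f x) x = c * multiplier w f x.
Proof.
intros w q c f x Hw Hf.
assert (H : is_lim_seq (fun N => multiplier_partial w (fun x => c * f x) N x) (c * multiplier
  w f x)).
{ apply is_lim_seq_ext with (fun N => c * multiplier_partial w f N x).
  - intros N. unfold multiplier_partial. rewrite <- Zpartial_scal. apply Zpartial_ext.
    intros n.
    unfold multiplier_term. destruct (coef_scal c f n) as [-> ->];
      auto using smooth_continuous_on_period. ring.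
  - apply (is_lim_seq_scal_l _ c (Finite _)). now apply multiplier_lim with q. }
assert (H2 := multiplier_lim w q _ x Hw (smooth_scal c _ Hf)).
apply is_lim_seq_unique in H. apply is_lim_seq_unique in H2. rewrite H in H2. now inversion H2.
Qed.

Lemma integral_multiplier : forall w q f g, admissible w q -> smooth_circle f ->
  smooth_circle g ->
  exists K, forall N,
  Rabs (integral (fun x => multiplier w f x * g x) -
    2 * PI * Zpartial (fun j => w j * (cos_coef f j * cos_coef g j + sin_coef f j * sin_coef g
      j)) N) <= K * / INR (S N).
Proof.
intros w q f g Hw Hf Hg.
destruct (multiplier_tail w q f Hw Hf) as [K [HK0 HK]].
destruct (smooth_bounded _ Hg) as [G HG].
assert (P := two_PI_pos).
exists (2 * PI * (K * G)). intros N.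
rewrite <- (integral_multiplier_partial w f g N) by now apply smooth_continuous_on_period.
rewrite <- (Rmult_assoc (2 * PI)), Rinv_r, Rmult_1_l by lra.
assert (HM := smooth_multiplier w q f Hw Hf).
rewrite <- int_minus by (apply smooth_ex_int, smooth_mult;
  auto using smooth_multiplier_partial).
replace (2 * PI * (K * G) * / INR (S N)) with (2 * PI * (K * / INR (S N) * G)) by ring.
apply int_abs_bound.
- apply smooth_ex_int, smooth_minus; apply smooth_mult; auto using smooth_multiplier_partial.
- intros x _. rewrite <- Rmult_minus_distr_r, Rabs_mult.
  apply Rmult_le_compat; auto using Rabs_pos.
Qed.

Lemma eq_0_of_le_inv_INR : forall a K N0, (forall N, (N0 <= N)%nat ->
  Rabs a <= K * / INR (S N)) -> a = 0.
Proof.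
intros a K N0 H. destruct (Req_dec a 0) as [h|h]; auto. exfalso.
assert (Ha := Rabs_pos_lt _ h).
assert (HK : 0 < Rabs K + 1) by (generalize (Rabs_pos K); lra).
destruct (inv_INR_small (Rabs a / (Rabs K + 1))) as [N1 HN1]; [now apply Rdiv_lt_0_compat|].
specialize (H (N0 + N1)%nat ltac:(lia)). specialize (HN1 (N0 + N1)%nat ltac:(lia)).
assert (0 < / INR (S (N0 + N1))) by (apply Rinv_0_lt_compat, lt_0_INR; lia).
apply Rmult_lt_compat_l with (r := Rabs K + 1) in HN1; auto.
replace ((Rabs K + 1) * (Rabs a / (Rabs K + 1))) with (Rabs a) in HN1 by (field; lra).
generalize (Rle_abs K). nra.
Qed.

(** The coefficient at n of the partial sums is w n times that of f as soon as
    N >= |n|, and uniform convergence carries this to the limit. *)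
Lemma coef_multiplier : forall w q f n, admissible w q -> smooth_circle f ->
  cos_coef (multiplier w f) n = w n * cos_coef f n /\
    sin_coef (multiplier w f) n = w n * sin_coef f n.
Proof.
intros w q f n Hw Hf. assert (P := two_PI_pos).
assert (G : forall g c, smooth_circle g ->
  (forall N, (Z.abs_nat n <= N)%nat ->
    / (2 * PI) * integral (fun x => multiplier_partial w f N x * g x) = c) ->
  / (2 * PI) * integral (fun x => multiplier w f x * g x) = c).
{ intros g c Hg Hc. destruct (integral_multiplier w q f g Hw Hf Hg) as [K HK].
  apply Rmult_eq_reg_l with (2 * PI); [|lra]. rewrite <- Rmult_assoc, Rinv_r, Rmult_1_l by lra.
  apply Rminus_diag_uniq. apply (eq_0_of_le_inv_INR _ K (Z.abs_nat n)). intros N HN.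
  rewrite <- (Hc N HN). rewrite (integral_multiplier_partial w f g N
    (smooth_continuous_on_period _ Hg)). apply HK. }
split.
- unfold cos_coef at 1. apply (G (cosn n)); auto using smooth_cosn. intros N HN.
  apply (coef_multiplier_partial w f N n (smooth_continuous_on_period _ Hf) (proj2 Hw) HN).
- unfold sin_coef at 1. apply (G (sinn n)); auto using smooth_sinn. intros N HN.
  apply (coef_multiplier_partial w f N n (smooth_continuous_on_period _ Hf) (proj2 Hw) HN).
Qed.

(** * Fourier inversion and Parseval's identity *)

(** By Bessel's inequality the squares of the coefficients are summable. *)
Lemma Riemann_Lebesgue : forall f, continuous_on_period f -> forall eps, 0 < eps ->
  exists n0, forall n, (n0 <= n)%nat ->
  Rabs (cos_coef f (Z.of_nat n)) <= eps /\ Rabs (sin_coef f (Z.of_nat n)) <= eps.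
Proof.
intros f Hf eps Heps.
set (c := fun n => cos_coef f n ^ 2 + sin_coef f n ^ 2).
assert (Hc : forall n, 0 <= c n).
{ intros n; unfold c. generalize (pow2_ge_0 (cos_coef f n)) (pow2_ge_0 (sin_coef f n)); lra. }
assert (P := two_PI_pos).
assert (L : ex_finite_lim_seq (Zpartial c)).
{ apply ex_finite_lim_seq_incr with (/ (2 * PI) * L2sq f).
  - intros n. cbn [Zpartial]. generalize (Hc (Z.of_nat (S n))) (Hc (- Z.of_nat (S n))%Z); lra.
  - intros n. apply Rmult_le_reg_l with (2 * PI); [lra|].
    rewrite <- Rmult_assoc, Rinv_r, Rmult_1_l by lra. exact (Bessel f n Hf). }
apply ex_lim_seq_cauchy_corr in L.
assert (He2 : 0 < eps ^ 2) by nra.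
destruct (L (mkposreal _ He2)) as [N HN]. exists (S N). intros [|n] Hn; [lia|].
specialize (HN (S n) n ltac:(lia) ltac:(lia)). cbn [Zpartial pos] in HN.
apply Rabs_lt_between in HN.
generalize (Hc (Z.of_nat (S n))) (Hc (- Z.of_nat (S n))%Z); intros H1 H2.
assert (H3 : c (Z.of_nat (S n)) <= eps ^ 2) by lra. unfold c in H3.
generalize (pow2_ge_0 (cos_coef f (Z.of_nat (S n)))) (pow2_ge_0 (sin_coef f (Z.of_nat (S
  n)))); intros.
split; apply Rabs_le; nra.
Qed.

(** The difference quotient, completed by the derivative: a quotient of two increments
    can then be treated as a continuous function without isolating the zero. *)
Definition slope (f : R -> R) (x y : R) : R :=
  if Req_EM_T y x then Derive f x else (f y - f x) / (y - x).

Lemma slope_mult : forall f x y, slope f x y * (y - x) = f y - f x.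
Proof. intros f x y; unfold slope. destruct (Req_EM_T y x) as [->|h]; [ring|field; lra]. Qed.

Lemma slope_continuous : forall (f : R -> R) x y, (forall z, ex_derive f z) ->
  continuous (slope f x) y.
Proof.
intros f x y Hf. destruct (Req_dec y x) as [->|h].
- apply continuity_pt_filterlim. intros eps Heps.
  assert (D := Derive_correct f x (Hf x)). apply is_derive_Reals in D.
  destruct (D eps Heps) as [d Hd]. exists d. split; [apply d|].
  intros z [[_ Hz] Hdist]. simpl in Hdist |- *. unfold R_dist in *.
  unfold slope. destruct (Req_EM_T z x) as [e|_]; [now elim Hz|].
  destruct (Req_EM_T x x) as [_|h]; [|now elim h].
  specialize (Hd (z - x) ltac:(lra) Hdist). rewrite (Rplus_minus x z) in Hd; exact Hd.
- apply continuous_ext_loc with (fun z => (f z - f x) / (z - x)).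
  + assert (He : 0 < Rabs (y - x)) by (apply Rabs_pos_lt; lra).
    exists (mkposreal _ He). intros z Hz. unfold slope.
    destruct (Req_EM_T z x) as [->|_]; [|reflexivity].
    change (Rabs (x - y) < Rabs (y - x)) in Hz. rewrite Rabs_minus_sym in Hz. lra.
  + apply (@ex_derive_continuous R_AbsRing R_NormedModule). auto_derive. split;
    [apply Hf|split; [lra|auto]].
Qed.

(** The closed form of the Dirichlet kernel, multiplied out by sin (z/2). Each new pair
    of cosines contributes a difference of consecutive sines. *)
Lemma Dirichlet_kernel : forall N z,
  sin (z / 2) * Zpartial (fun j => cos (IZR j * z)) N = sin (INR N * z + z / 2).
Proof.
intros N z. induction N as [|N IH]; cbn [Zpartial].
- simpl. rewrite !Rmult_0_l, cos_0, Rplus_0_l. ring.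
- rewrite Rmult_plus_distr_l, IH, opp_IZR, Ropp_mult_distr_l_reverse, cos_neg, <- INR_IZR_INZ,
  S_INR.
  replace (INR N * z + z / 2) with ((INR N + 1) * z - z / 2) by field.
  rewrite sin_plus, sin_minus. ring.
Qed.

Lemma sin_half_nonzero : forall z, - (2 * PI) < z < 2 * PI -> z <> 0 -> sin (z / 2) <> 0.
Proof.
intros z Hz h. destruct (Rlt_dec 0 z).
- apply Rgt_not_eq, sin_gt_0; lra.
- replace (z / 2) with (- (- z / 2)) by field. rewrite sin_neg.
  assert (0 < sin (- z / 2)) by (apply sin_gt_0; lra). lra.
Qed.

Lemma multiplier_partial_sub_const : forall f c N x, smooth_circle f ->
  multiplier_partial (fun _ => 1) (fun y => f y - c) N x
    = multiplier_partial (fun _ => 1) f N x - c.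
Proof.
intros f c N x Hf. assert (P := PI_RGT_0).
assert (E : forall j, multiplier_term (fun _ => 1) (fun y => f y - c) x j =
   multiplier_term (fun _ => 1) f x j + -1 * multiplier_term (fun _ => 1) (fun _ => c) x j).
{ intros j. unfold multiplier_term. destruct (coef_minus f (fun _ => c) j) as [-> ->];
  auto using smooth_continuous_on_period, smooth_const. ring. }
unfold multiplier_partial. rewrite (Zpartial_ext _ _ N E), Zpartial_plus, Zpartial_scal.
rewrite (Zpartial_pick0 (multiplier_term (fun _ => 1) (fun _ => c) x)).
- assert (C1 : cos_coef (fun _ => c) 0 = c).
  { unfold cos_coef. rewrite (int_ext _ (fun _ => c)) by (intros; rewrite Rmult_0_l, cos_0;
    ring).
    rewrite int_const. field; lra. }
  unfold multiplier_term at 2. unfold cosn, sinn. rewrite !Rmult_0_l, cos_0, sin_0, C1. ring.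
- intros j Hj. assert (Hj' : IZR j <> 0) by now apply not_0_IZR.
  assert (D0 : Derive (fun _ : R => c) = fun _ => 0 * 0).
  { apply functional_extensionality; intros; rewrite Derive_const; ring. }
  assert (H1 := cos_coef_Derive (fun _ => c) j (smooth_const c)).
  assert (H2 := sin_coef_Derive (fun _ => c) j (smooth_const c)).
  rewrite D0 in H1, H2.
  destruct (coef_scal 0 (fun _ => 0) j) as [e1 e2];
    auto using smooth_continuous_on_period, smooth_const.
  rewrite e1 in H1. rewrite e2 in H2. unfold multiplier_term.
  replace (cos_coef (fun _ => c) j) with 0 by (apply Rmult_eq_reg_l with (IZR j); auto; lra).
  replace (sin_coef (fun _ => c) j) with 0 by (apply Rmult_eq_reg_l with (IZR j); auto; lra).
  ring.
Qed.

Lemma multiplier_partial_Dirichlet : forall h N x, continuous_on_period h ->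
  multiplier_partial (fun _ => 1) h N x =
  / (2 * PI) * integral (fun y => h y * Zpartial (fun j => cos (IZR j * (y - x))) N).
Proof.
intros h N x Hh.
assert (T : forall j, / (2 * PI) * integral (fun y => h y * cos (IZR j * (y - x)))
  = multiplier_term (fun _ => 1) h x j).
{ intros j. unfold multiplier_term.
  rewrite (int_ext _ (fun y => cosn j x * (h y * cos (IZR j * y)) + sinn j x * (h y * sin (IZR
    j * y)))).
  - assert (I1 := ex_int_mult_cosn h j Hh). assert (I2 := ex_int_mult_sinn h j Hh).
    rewrite int_plus, !int_scal by auto using ex_int_scal.
    unfold cos_coef, sin_coef. ring.
  - intros y. rewrite Rmult_minus_distr_l, cos_minus. unfold cosn, sinn. ring. }
assert (C : forall j, continuous_on_period (fun y => cos (IZR j * (y - x)))).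
{ intros j y _. apply (@ex_derive_continuous R_AbsRing R_NormedModule). auto_derive. auto. }
assert (CZ : forall N, continuous_on_period (fun y => Zpartial (fun j => cos (IZR j * (y -
  x))) N)).
{ induction N0 as [|M IH]; cbn [Zpartial]; [apply C|]. auto using continuous_on_period_plus. }
unfold multiplier_partial. induction N as [|N IH]; cbn [Zpartial]; [now rewrite T|].
rewrite IH, <- !T, <- !Rmult_plus_distr_l. f_equal.
rewrite <- !int_plus by auto using continuous_on_period_integrable, continuous_on_period_mult,
  continuous_on_period_plus.
apply int_ext; intros; ring.
Qed.

(** Dirichlet's argument. For x inside the period, sin ((y-x)/2) vanishes on it only at
    y = x, so G(y) = (f(y) - f(x)) / (2 sin ((y-x)/2)) is continuous. Against the
    Dirichlet kernel the denominator disappears, and the error of the N-th partial sum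
    is a combination of the N-th Fourier coefficients of G cos ((y-x)/2) and
    G sin ((y-x)/2), which tend to 0. Interior points are enough for integrals. *)
Lemma Fourier_inversion : forall f x, smooth_circle f -> 0 < x < 2 * PI ->
  multiplier (fun _ => 1) f x = f x.
Proof.
intros f x Hf Hx.
assert (A : admissible (fun _ => 1) 0) by (split; intros; simpl; [rewrite Rabs_R1;
  lra|reflexivity]).
assert (L := multiplier_lim _ _ f x A Hf).
set (g := fun y => 2 * sin ((y - x) / 2)).
assert (Hg : forall z, ex_derive g z) by (intros z; unfold g; auto_derive; auto).
set (G := fun y => slope f x y * / slope g x y).
assert (Gx : g x = 0) by (unfold g; rewrite Rminus_diag, Rdiv_0_l, sin_0; ring).
assert (Sg : forall y, 0 <= y <= 2 * PI -> slope g x y <> 0).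
{ intros y Hy. unfold slope. destruct (Req_EM_T y x) as [e|e].
  - replace (Derive g x) with 1; [lra|]. symmetry. apply is_derive_unique. unfold g.
    auto_derive; auto. unfold Rminus. rewrite Rplus_opp_r, Rmult_0_l, cos_0. field.
  - rewrite Gx. unfold g. assert (H := sin_half_nonzero (y - x) ltac:(lra) ltac:(lra)).
    intros E. apply H. apply Rmult_eq_reg_r with (2 * / (y - x)).
    + unfold Rdiv in E. rewrite Rmult_0_l, <- E. unfold Rdiv. ring.
    + assert (/ (y - x) <> 0) by (apply Rinv_neq_0_compat; lra). lra. }
assert (CG : continuous_on_period G).
{ intros y Hy. apply cont_mult.
  - apply slope_continuous. intros; now apply smooth_ex_derive.
  - apply (continuous_comp (slope g x) Rinv).
    + now apply slope_continuous.
    + apply continuous_Rinv. now apply Sg. }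
assert (EG : forall y, 0 <= y <= 2 * PI -> f y - f x = G y * g y).
{ intros y Hy. rewrite <- slope_mult. replace (g y) with (g y - g x) by (rewrite Gx; ring).
  rewrite <- (slope_mult g). unfold G. field. now apply Sg. }
set (c := fun y => cos ((y - x) / 2)). set (s := fun y => sin ((y - x) / 2)).
assert (Cc : continuous_on_period c) by (intros y _;
  apply (@ex_derive_continuous R_AbsRing R_NormedModule); unfold c; auto_derive; auto).
assert (Cs : continuous_on_period s) by (intros y _;
  apply (@ex_derive_continuous R_AbsRing R_NormedModule); unfold s; auto_derive; auto).
assert (CGc := continuous_on_period_mult _ _ CG Cc).
assert (CGs := continuous_on_period_mult _ _ CG Cs).
assert (E : forall N, multiplier_partial (fun _ => 1) f N x - f x =
  2 * (cosn (Z.of_nat N) x * sin_coef (fun y => G y * c y) (Z.of_nat N) - sinn (Z.of_nat N) x * cos_coef (fun y => G y * c y) (Z.of_nat N)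
  + cosn (Z.of_nat N) x * cos_coef (fun y => G y * s y) (Z.of_nat N) + sinn (Z.of_nat N) x *
    sin_coef (fun y => G y * s y) (Z.of_nat N))).
{ intros N. rewrite <- multiplier_partial_sub_const by assumption.
  rewrite multiplier_partial_Dirichlet by (apply continuous_on_period_minus;
    apply smooth_continuous_on_period; auto using smooth_const).
  set (n := Z.of_nat N).
  assert (I1 := continuous_on_period_integrable _ (continuous_on_period_mult _ _ CGc
    (smooth_continuous_on_period _ (smooth_sinn n)))).
  assert (I2 := continuous_on_period_integrable _ (continuous_on_period_mult _ _ CGc
    (smooth_continuous_on_period _ (smooth_cosn n)))).
  assert (I3 := continuous_on_period_integrable _ (continuous_on_period_mult _ _ CGs
    (smooth_continuous_on_period _ (smooth_cosn n)))).
  assert (I4 := continuous_on_period_integrable _ (continuous_on_period_mult _ _ CGs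
    (smooth_continuous_on_period _ (smooth_sinn n)))).
  transitivity (/ (2 * PI) * integral (fun y =>
    2 * ((cosn n x * (G y * c y * sinn n y) - sinn n x * (G y * c y * cosn n y))
       + (cosn n x * (G y * s y * cosn n y) + sinn n x * (G y * s y * sinn n y))))).
  - f_equal. apply int_ext_in. intros y Hy.
    rewrite EG by lra. unfold g.
    replace (G y * (2 * sin ((y - x) / 2)) * Zpartial (fun j => cos (IZR j * (y - x))) N) with
      (2 * G y * (sin ((y - x) / 2) * Zpartial (fun j => cos (IZR j * (y - x))) N)) by ring.
    rewrite Dirichlet_kernel, sin_plus, Rmult_minus_distr_l, sin_minus, cos_minus.
    unfold c, s, cosn, sinn, n. rewrite <- INR_IZR_INZ. ring.
  - rewrite int_scal, int_plus, int_minus, int_plus, !int_scal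
      by auto 6 using ex_int_plus, ex_int_minus, ex_int_scal.
    unfold cos_coef, sin_coef, cosn, sinn. ring. }
assert (L' : is_lim_seq (fun N => multiplier_partial (fun _ => 1) f N x) (f x)).
{ apply is_lim_seq_spec. intros eps.
  (* The error is twice a sum of four products of size at most eps / 10. *)
  assert (He : 0 < eps / 10) by (generalize (cond_pos eps); lra).
  destruct (Riemann_Lebesgue _ CGc _ He) as [n1 H1].
  destruct (Riemann_Lebesgue _ CGs _ He) as [n2 H2].
  exists (n1 + n2)%nat. intros n Hn. rewrite E.
  destruct (H1 n ltac:(lia)) as [A1 A2]. destruct (H2 n ltac:(lia)) as [A3 A4].
  assert (B1 : Rabs (cosn (Z.of_nat n) x) <= 1) by apply Rabs_le, COS_bound.
  assert (B2 : Rabs (sinn (Z.of_nat n) x) <= 1) by apply Rabs_le, SIN_bound.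
  assert (M : forall u v, Rabs u <= 1 -> Rabs v <= eps / 10 -> - (eps / 10) <= u * v
    <= eps / 10).
  { intros u v Hu Hv. apply Rabs_le_between. rewrite Rabs_mult.
    generalize (Rabs_pos u) (Rabs_pos v); nra. }
  assert (M1 := M _ _ B1 A2). assert (M2 := M _ _ B2 A1). assert (M3 := M _ _ B1 A3).
  assert (M4 := M _ _ B2 A4).
  apply Rabs_lt_between. generalize (cond_pos eps). lra. }
apply is_lim_seq_unique in L. apply is_lim_seq_unique in L'. rewrite L in L'. now inversion L'.
Qed.

(** The half of Parseval's identity that expresses completeness of the trigonometric
    system. *)
Lemma Parseval_le : forall f, smooth_circle f -> exists K, forall N,
  L2sq f <= 2 * PI * Zpartial (fun n => cos_coef f n ^ 2 + sin_coef f n ^ 2) N + K * / INR (S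
    N).
Proof.
intros f Hf.
assert (A : admissible (fun _ => 1) 0) by (split; intros; simpl; [rewrite Rabs_R1;
  lra|reflexivity]).
destruct (integral_multiplier _ _ f f A Hf Hf) as [K HK]. exists K. intros N.
specialize (HK N).
replace (integral (fun x => multiplier (fun _ => 1) f x * f x)) with (L2sq f) in HK.
- rewrite (Zpartial_ext _ (fun n => cos_coef f n ^ 2 + sin_coef f n ^ 2)) in HK by (intros;
  ring).
  apply Rabs_le_between in HK. lra.
- apply int_ext_in. intros x Hx.
  rewrite Fourier_inversion by auto. ring.
Qed.

(** Ellipticity: a multiplier whose symbol dominates n^2 controls two derivatives.
    Completeness is used for f'' and Bessel's inequality for the image of f. *)
Lemma L2sq_second_derivative : forall w q f, admissible w q -> smooth_circle f ->
  (forall n, IZR n ^ 2 <= w n) ->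
  L2sq (Derive_n f 2) <= L2sq (multiplier w f).
Proof.
intros w q f Hw Hf Hl. assert (P := two_PI_pos).
assert (Hf2 := smooth_Derive_n f 2 Hf). assert (HM := smooth_multiplier w q f Hw Hf).
destruct (Parseval_le _ Hf2) as [K HK].
destruct (Rle_dec (L2sq (Derive_n f 2)) (L2sq (multiplier w f))) as [h|h]; auto.
exfalso. apply h. apply Req_le, Rminus_diag_uniq.
apply (eq_0_of_le_inv_INR _ K 0). intros N _. rewrite Rabs_pos_eq by lra.
specialize (HK N). assert (B := Bessel _ N (smooth_continuous_on_period _ HM)).
enough (Zpartial (fun n => cos_coef (Derive_n f 2) n ^ 2 + sin_coef (Derive_n f 2) n ^ 2) N <=
        Zpartial (fun n => cos_coef (multiplier w f) n ^ 2 + sin_coef (multiplier w f) n ^ 2)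
          N) by nra.
apply Zpartial_le. intros n.
destruct (coef_Derive2 f n Hf) as [-> ->]. destruct (coef_multiplier w q f n Hw Hf) as [-> ->].
specialize (Hl n). assert (S := pow2_ge_0 (IZR n)). set (r := IZR n ^ 2) in *.
assert (r * r <= w n * w n) by nra.
generalize (pow2_ge_0 (cos_coef f n)) (pow2_ge_0 (sin_coef f n)). nra.
Qed.

Lemma coef_Derive_sqr : forall f k n, smooth_circle f ->
  cos_coef (Derive_n f k) n ^ 2 + sin_coef (Derive_n f k) n ^ 2
    = (IZR n ^ 2) ^ k * (cos_coef f n ^ 2 + sin_coef f n ^ 2).
Proof.
intros f k n Hf. induction k as [|k IH]; [change (Derive_n f 0) with f; simpl; ring|].
change (Derive_n f (S k)) with (Derive (Derive_n f k)).
rewrite cos_coef_Derive, sin_coef_Derive by now apply smooth_Derive_n.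
change ((IZR n ^ 2) ^ S k) with (IZR n ^ 2 * (IZR n ^ 2) ^ k).
replace ((IZR n * sin_coef (Derive_n f k) n) ^ 2 + (- IZR n * cos_coef (Derive_n f k) n) ^ 2)
  with
  (IZR n ^ 2 * (cos_coef (Derive_n f k) n ^ 2 + sin_coef (Derive_n f k) n ^ 2)) by ring.
rewrite IH. ring.
Qed.

Lemma Cmod_fourier : forall f n, Cmod (fourier_coef f n) ^ 2
  = cos_coef f n ^ 2 + sin_coef f n ^ 2.
Proof.
intros f n. unfold Cmod. rewrite pow2_sqrt.
- unfold fourier_coef, cos_coef, sin_coef, integral; simpl fst; simpl snd. ring.
- simpl. nra.
Qed.

Lemma pow_weight_le : forall z k, 0 <= z -> (1 + z) ^ k <= 2 ^ k * (1 + z ^ k).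
Proof.
intros z k Hz. destruct (Rle_dec z 1).
- apply Rle_trans with (2 ^ k); [apply pow_incr; lra|].
  assert (0 <= z ^ k) by now apply pow_le. assert (0 < 2 ^ k) by (apply pow_lt; lra). nra.
- apply Rle_trans with ((2 * z) ^ k); [apply pow_incr; lra|].
  rewrite Rpow_mult_distr. assert (0 < 2 ^ k) by (apply pow_lt; lra). nra.
Qed.

(** Since (1+n^2)^k <= 2^k (1 + n^(2k)), the defining series splits into the squared
    coefficients of f and of its k-th derivative. *)
Lemma sobolev_norm_sqr : forall k f, smooth_circle f ->
  exists r, Rbar_sqr (sobolev_norm k f) = Finite r /\
  r <= 2 ^ k * / (2 * PI) * (L2sq f + L2sq (Derive_n f k)).
Proof.
intros k f Hf. assert (P := two_PI_pos).
set (c := fun n : Z => (1 + IZR n ^ 2) ^ k * Cmod (fourier_coef f n) ^ 2).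
set (B := 2 ^ k * / (2 * PI) * (L2sq f + L2sq (Derive_n f k))).
assert (Hpos : forall n, 0 <= c n).
{ intros n. apply Rmult_le_pos;
  [|apply pow2_ge_0]. apply pow_le. generalize (pow2_ge_0 (IZR n)); lra. }
assert (HB : forall N, Zpartial c N <= B).
{ intros N.
  apply Rle_trans with (Zpartial (fun n => 2 ^ k * ((cos_coef f n ^ 2 + sin_coef f n ^ 2) +
    (cos_coef (Derive_n f k) n ^ 2 + sin_coef (Derive_n f k) n ^ 2))) N).
  - apply Zpartial_le. intros n. unfold c. rewrite Cmod_fourier, coef_Derive_sqr by assumption.
    assert (H := pow_weight_le (IZR n ^ 2) k (pow2_ge_0 _)).
    assert (0 <= cos_coef f n ^ 2 + sin_coef f n ^ 2)
      by (generalize (pow2_ge_0 (cos_coef f n)) (pow2_ge_0 (sin_coef f n)); lra).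
    apply Rle_trans with (2 ^ k * (1 + (IZR n ^ 2) ^ k) * (cos_coef f n ^ 2 + sin_coef f n ^
      2)).
    + now apply Rmult_le_compat_r.
    + right; ring.
  - rewrite Zpartial_scal, Zpartial_plus. unfold B. rewrite Rmult_assoc.
    apply Rmult_le_compat_l; [apply pow_le; lra|].
    apply Rmult_le_reg_l with (2 * PI); [lra|].
    rewrite <- (Rmult_assoc (2 * PI)), Rinv_r, Rmult_1_l, Rmult_plus_distr_l by lra.
    apply Rplus_le_compat.
    + exact (Bessel f N (smooth_continuous_on_period _ Hf)).
    + exact (Bessel (Derive_n f k) N (smooth_continuous_on_period _ (smooth_Derive_n f k
      Hf))). }
assert (L1 : Rbar_le (Finite 0) (Zseries c)).
{ rewrite <- (Lim_seq_const 0). apply Lim_seq_le_loc. exists 0%nat. intros.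
now apply Zpartial_nonneg. }
assert (L2 : Rbar_le (Zseries c) (Finite B)).
{ rewrite <- (Lim_seq_const B). apply Lim_seq_le_loc. exists 0%nat. auto. }
unfold sobolev_norm. fold c. destruct (Zseries c) as [r| |]; try (now elim L1) || now elim L2.
exists r. split; [|exact L2]. unfold Rbar_sqr, Rbar_sqrt. simpl. f_equal. now apply sqrt_sqrt.
Qed.

(** * Curves of smooth functions *)

(** Uniformity in x is what makes integrals over the circle differentiable in time. *)
Definition unif_deriv (W : R -> R -> R) (v : R -> R) (t : R) : Prop :=
  forall eps, 0 < eps -> exists d, 0 < d /\ forall h, h <> 0 -> Rabs h < d ->
  forall x, Rabs ((W (t + h) x - W t x) / h - v x) <= eps.

(** Differentiability in the Frechet space of smooth functions, stated pointwise to
    avoid suprema in the extended reals. *)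
Definition flow (J : R -> Prop) (W W' : R -> R -> R) : Prop :=
  (forall t, J t -> smooth_circle (W t)) /\
  (forall t, J t -> smooth_circle (W' t)) /\
  forall t k, J t -> unif_deriv (fun t => Derive_n (W t) k) (Derive_n (W' t) k) t.

Lemma open_step : forall (J : R -> Prop) t, open J -> J t ->
  exists d, 0 < d /\ forall h, Rabs h < d -> J (t + h).
Proof.
intros J t HJ Ht. destruct (HJ t Ht) as [d Hd]. exists d. split; [apply cond_pos|].
intros h Hh. apply Hd. change (Rabs (t + h - t) < d). now replace (t + h - t) with h by ring.
Qed.

Lemma supnorm_lt : forall f e x, Rbar_lt (supnorm f) (Finite e) -> Rabs (f x) <= e.
Proof.
intros f e x H. destruct (Lub_Rbar_correct (fun y => exists x, y = Rabs (f x))) as [U _].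
specialize (U (Rabs (f x)) (ex_intro _ x eq_refl)). fold (supnorm f) in U.
assert (L := Rbar_le_lt_trans _ _ _ U H). simpl in L. lra.
Qed.

Lemma supnorm_le : forall f e x, Rbar_le (supnorm f) (Finite e) -> Rabs (f x) <= e.
Proof.
intros f e x H. destruct (Lub_Rbar_correct (fun y => exists x, y = Rabs (f x))) as [U _].
specialize (U (Rabs (f x)) (ex_intro _ x eq_refl)). fold (supnorm f) in U.
exact (Rbar_le_trans _ _ _ U H).
Qed.

Lemma Derive_n_quotient : forall f g v h n,
  smooth_circle f -> smooth_circle g -> smooth_circle v ->
  Derive_n (fun x => (f x - g x) / h - v x) n =
  fun x => (Derive_n f n x - Derive_n g n x) / h - Derive_n v n x.
Proof.
intros f g v h n Hf Hg Hv.
replace (fun x => (f x - g x) / h - v x) with (fun x => / h * (f x - g x) - v x)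
  by (apply functional_extensionality; intros; unfold Rdiv; ring).
rewrite Derive_n_minus_fun, Derive_n_scal_fun, Derive_n_minus_fun;
  auto using smooth_scal, smooth_minus.
apply functional_extensionality; intros; unfold Rdiv; ring.
Qed.

Lemma smooth_quotient : forall f g v h,
  smooth_circle f -> smooth_circle g -> smooth_circle v ->
  smooth_circle (fun x => (f x - g x) / h - v x).
Proof.
intros f g v h Hf Hg Hv.
replace (fun x => (f x - g x) / h - v x) with (fun x => / h * (f x - g x) - v x)
  by (apply functional_extensionality; intros; unfold Rdiv; ring).
auto using smooth_scal, smooth_minus.
Qed.

Lemma smooth_curve_flow : forall J U, open J -> smooth_curve J U -> exists V, flow J U V.
Proof.
intros J U HJ [V [<- [HS HD]]]. exists (V 1%nat).
repeat split; try (intros; now apply HS).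
intros t k Ht eps Heps.
destruct (HD 0%nat t Ht k (mkposreal eps Heps)) as [d1 Hd1].
destruct (open_step J t HJ Ht) as [d2 [Hd2 HJ2]].
exists (Rmin d1 d2). split; [apply Rmin_pos; [apply cond_pos|auto]|].
intros h Hh0 Hh x.
assert (Rmin d1 d2 <= d1) by apply Rmin_l. assert (Rmin d1 d2 <= d2) by apply Rmin_r.
assert (Hb : ball 0 d1 h) by (change (Rabs (h - 0) < d1); rewrite Rminus_0_r; lra).
specialize (Hd1 h Hb Hh0). apply supnorm_lt with (x := x) in Hd1.
rewrite Derive_n_quotient in Hd1; [exact Hd1| | |]; apply HS; auto. apply HJ2; lra.
Qed.

Lemma flow_Derive_n : forall J W W' k, flow J W W' ->
  flow J (fun t => Derive_n (W t) k) (fun t => Derive_n (W' t) k).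
Proof.
intros J W W' k [H1 [H2 H3]]. repeat split; try (intros; apply smooth_Derive_n; auto).
intros t j Ht eps Heps. destruct (H3 t (j + k)%nat Ht eps Heps) as [d [Hd H]].
exists d; split; auto. intros h Hh0 Hh x. rewrite !Derive_n_comp. now apply H.
Qed.

Lemma flow_unif : forall J W W' t, flow J W W' -> J t -> unif_deriv W (W' t) t.
Proof. intros J W W' t [_ [_ H]] Ht. exact (H t 0%nat Ht). Qed.

Lemma unif_deriv_pointwise : forall W v t x, unif_deriv W v t ->
  is_derive (fun t => W t x) t (v x).
Proof.
intros W v t x H. apply is_derive_Reals. intros eps Heps.
destruct (H (eps / 2) ltac:(lra)) as [d [Hd Hh]]. exists (mkposreal d Hd).
intros h Hh0 Hhd. specialize (Hh h Hh0 Hhd x). cbv beta. lra.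
Qed.

Lemma flow_finite : forall J W W' t m eps, flow J W W' -> J t -> 0 < eps ->
  exists d, 0 < d /\ forall h, h <> 0 -> Rabs h < d -> forall k x, (k <= m)%nat ->
  Rabs ((Derive_n (W (t + h)) k x - Derive_n (W t) k x) / h - Derive_n (W' t) k x) <= eps.
Proof.
intros J W W' t m eps HF Ht Heps. induction m as [|m [d1 [Hd1 H1]]].
- destruct (proj2 (proj2 HF) t 0%nat Ht eps Heps) as [d [Hd H]]. exists d; split; auto.
  intros h Hh0 Hh k x Hk. replace k with 0%nat by lia. now apply H.
- destruct (proj2 (proj2 HF) t (S m) Ht eps Heps) as [d2 [Hd2 H2]].
  exists (Rmin d1 d2). split; [now apply Rmin_pos|]. intros h Hh0 Hh k x Hk.
  assert (Rmin d1 d2 <= d1) by apply Rmin_l. assert (Rmin d1 d2 <= d2) by apply Rmin_r.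
  destruct (Nat.eq_dec k (S m)) as [->|E].
  + apply H2; auto; lra.
  + apply H1; auto; [lra|lia].
Qed.

Lemma Helmholtz_pow_le : forall p f eps, smooth_circle f ->
  (forall k x, (k <= 2 * p)%nat -> Rabs (Derive_n f k x) <= eps) ->
  forall x, Rabs (Helmholtz_pow p f x) <= 2 ^ p * eps.
Proof.
induction p as [|p IH]; intros f eps Hf H x.
- simpl. rewrite Rmult_1_l. apply (H 0%nat x). lia.
- simpl Helmholtz_pow. replace (2 ^ S p * eps) with (2 ^ p * (2 * eps)) by (simpl; ring).
  apply IH; [now apply smooth_Helmholtz|]. intros k y Hk. unfold Helmholtz.
  rewrite Derive_n_minus_fun, Derive_n_comp by (auto; now apply (smooth_Derive_n f 2)).
  assert (H1 := H k y ltac:(lia)). assert (H2 := H (k + 2)%nat y ltac:(lia)).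
  apply Rabs_le_between in H1. apply Rabs_le_between in H2. apply Rabs_le. lra.
Qed.

(** A multiplier is linear and continuous on smooth functions: applied to the remainder
    of a difference quotient it is small, because finitely many derivatives of that
    remainder are. *)
Lemma flow_multiplier : forall J w q W W', open J -> admissible w q -> flow J W W' ->
  flow J (fun t => multiplier w (W t)) (fun t => multiplier w (W' t)).
Proof.
intros J w q W W' HJ Hw HF. assert (HF' := HF). destruct HF' as [H1 [H2 _]].
split; [intros; apply smooth_multiplier with q; auto|].
split; [intros; apply smooth_multiplier with q; auto|].
intros t k Ht eps Heps.
assert (P2 : 0 < 2 ^ S q) by (apply pow_lt; lra).
(* 10 is the constant of multiplier_bound, 2 ^ S q that of Helmholtz_pow_le. *)
set (e := eps / (10 * 2 ^ S q)).
assert (He : 0 < e) by (apply Rdiv_lt_0_compat; lra).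
destruct (flow_finite J W W' t (2 * S q + k) e HF Ht He) as [d1 [Hd1 K1]].
destruct (open_step J t HJ Ht) as [d2 [Hd2 HJ2]].
exists (Rmin d1 d2). split; [now apply Rmin_pos|]. intros h Hh0 Hh x.
assert (Rmin d1 d2 <= d1) by apply Rmin_l. assert (Rmin d1 d2 <= d2) by apply Rmin_r.
assert (Sth := H1 (t + h) (HJ2 h ltac:(lra))). assert (St := H1 t Ht). assert (Sv := H2 t Ht).
rewrite !(Derive_n_multiplier w q) by assumption.
set (r := fun y => (Derive_n (W (t + h)) k y - Derive_n (W t) k y) / h - Derive_n (W' t) k y).
assert (Sr : smooth_circle r) by (apply smooth_quotient; now apply smooth_Derive_n).
replace ((multiplier w (Derive_n (W (t + h)) k) x - multiplier w (Derive_n (W t) k) x) / h -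
  multiplier w (Derive_n (W' t) k) x) with (multiplier w r x).
- replace eps with (10 * (2 ^ S q * e)) by (unfold e; field; lra).
  apply multiplier_bound with q; auto. intros y. apply Helmholtz_pow_le; auto.
  intros j z Hj. unfold r. rewrite Derive_n_quotient by now apply smooth_Derive_n.
  rewrite !Derive_n_comp. apply K1; auto; [lra|lia].
- unfold r.
  replace (fun y => (Derive_n (W (t + h)) k y - Derive_n (W t) k y) / h - Derive_n (W' t) k y)
    with (fun y => / h * (Derive_n (W (t + h)) k y - Derive_n (W t) k y) - Derive_n (W' t) k y)
    by (apply functional_extensionality; intros; unfold Rdiv; ring).
  rewrite (multiplier_minus w q), (multiplier_scal w q), (multiplier_minus w q);
    auto using smooth_Derive_n, smooth_scal, smooth_minus. unfold Rdiv; ring.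
Qed.

Lemma unif_deriv_mult : forall W Z v z t B,
  (forall x, Rabs (W t x) <= B) -> (forall x, Rabs (Z t x) <= B) ->
  (forall x, Rabs (v x) <= B) -> (forall x, Rabs (z x) <= B) ->
  unif_deriv W v t -> unif_deriv Z z t ->
  unif_deriv (fun t x => W t x * Z t x) (fun x => v x * Z t x + W t x * z x) t.
Proof.
intros W Z v z t B BW BZ Bv Bz HW HZ eps Heps.
assert (HB : 0 <= B) by (eapply Rle_trans; [apply Rabs_pos|apply (BW 0)]).
set (e := Rmin 1 (eps / (4 * (B + 1)))).
assert (He : 0 < e) by (apply Rmin_pos; [lra|apply Rdiv_lt_0_compat; lra]).
assert (He1 : e <= 1) by apply Rmin_l.
assert (He2 : B * e <= eps / 4).
{ assert (e <= eps / (4 * (B + 1))) by apply Rmin_r.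
  apply Rle_trans with (B * (eps / (4 * (B + 1)))); [now apply Rmult_le_compat_l|].
  replace (eps / 4) with ((B + 1) * (eps / (4 * (B + 1)))) by (field; lra).
  assert (0 < eps / (4 * (B + 1))) by (apply Rdiv_lt_0_compat; lra). nra. }
destruct (HW e He) as [d1 [Hd1 K1]]. destruct (HZ e He) as [d2 [Hd2 K2]].
set (d3 := eps / (2 * (B + 1) ^ 2)).
assert (HB2 : 0 < (B + 1) ^ 2) by nra.
assert (Hd3 : 0 < d3) by (apply Rdiv_lt_0_compat; lra).
exists (Rmin (Rmin d1 d2) d3). split; [repeat apply Rmin_pos; auto|].
intros h Hh0 Hh x.
assert (Rmin (Rmin d1 d2) d3 <= d1) by (eapply Rle_trans; [apply Rmin_l|apply Rmin_l]).
assert (Rmin (Rmin d1 d2) d3 <= d2) by (eapply Rle_trans; [apply Rmin_l|apply Rmin_r]).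
assert (Rmin (Rmin d1 d2) d3 <= d3) by apply Rmin_r.
specialize (K1 h Hh0 ltac:(lra) x). specialize (K2 h Hh0 ltac:(lra) x).
specialize (BW x). specialize (BZ x). specialize (Bv x). specialize (Bz x).
set (p := (W (t + h) x - W t x) / h) in *. set (r := (Z (t + h) x - Z t x) / h) in *.
replace ((W (t + h) x * Z (t + h) x - W t x * Z t x) / h - (v x * Z t x + W t x * z x))
  with (W t x * (r - z x) + Z t x * (p - v x) + h * (p * r)) by (unfold p, r; field; auto).
assert (Bp : Rabs p <= B + 1).
{ replace p with ((p - v x) + v x) by ring. eapply Rle_trans; [apply Rabs_triang|]. lra. }
assert (Br : Rabs r <= B + 1).
{ replace r with ((r - z x) + z x) by ring. eapply Rle_trans; [apply Rabs_triang|]. lra. }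
assert (M1 : Rabs (W t x * (r - z x)) <= B * e).
{ rewrite Rabs_mult. apply Rmult_le_compat; auto using Rabs_pos. }
assert (M2 : Rabs (Z t x * (p - v x)) <= B * e).
{ rewrite Rabs_mult. apply Rmult_le_compat; auto using Rabs_pos. }
assert (M3 : Rabs (h * (p * r)) <= eps / 2).
{ rewrite !Rabs_mult. replace (eps / 2) with (d3 * ((B + 1) * (B + 1))) by (unfold d3; field;
  lra).
  apply Rmult_le_compat; try apply Rabs_pos; [|lra|].
  - apply Rmult_le_pos; apply Rabs_pos.
  - apply Rmult_le_compat; auto using Rabs_pos. }
eapply Rle_trans; [apply Rabs_triang|].
eapply Rle_trans; [apply Rplus_le_compat_r, Rabs_triang|]. lra.
Qed.

Lemma unif_deriv_pow : forall W v t n, smooth_circle (W t) -> smooth_circle v ->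
  unif_deriv W v t ->
  unif_deriv (fun t x => W t x ^ n) (fun x => INR n * W t x ^ (n - 1) * v x) t.
Proof.
intros W v t n HW Hv H. induction n as [|n IH].
- intros eps Heps. exists 1. split; [lra|]. intros h Hh0 _ x. simpl.
  replace ((1 - 1) / h - 0 * 1 * v x) with 0 by (field; auto). rewrite Rabs_R0; lra.
- replace (fun x => INR (S n) * W t x ^ (S n - 1) * v x) with
    (fun x => v x * W t x ^ n + W t x * (INR n * W t x ^ (n - 1) * v x)).
  + assert (Hz : smooth_circle (fun x => INR n * W t x ^ (n - 1) * v x))
      by (apply smooth_mult; auto; apply smooth_scal; now apply smooth_pow).
    destruct (smooth_bounded _ HW) as [B1 K1]. destruct (smooth_bounded _ Hv) as [B2 K2].
    destruct (smooth_bounded _ (smooth_pow _ n HW)) as [B3 K3].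
    destruct (smooth_bounded _ Hz) as [B4 K4].
    assert (P : forall (f : R -> R) B, (forall x, Rabs (f x) <= B) -> 0 <= B).
    { intros f B Hf. eapply Rle_trans; [apply Rabs_pos|apply (Hf 0)]. }
    generalize (P _ _ K1) (P _ _ K2) (P _ _ K3) (P _ _ K4); intros.
    apply (unif_deriv_mult W (fun t x => W t x ^ n) v _ t (B1 + B2 + B3 + B4)); auto; intros x;
    [specialize (K1 x)|specialize (K3 x)|specialize (K2 x)|specialize (K4 x)]; lra.
  + apply functional_extensionality; intros x. rewrite S_INR. destruct n as [|n].
    * simpl. ring.
    * replace (S (S n) - 1)%nat with (S n) by lia. replace (S n - 1)%nat with n by lia.
      rewrite <- (tech_pow_Rmult _ n). ring.
Qed.

Lemma unif_deriv_integral : forall J W v t, open J -> J t ->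
  (forall t, J t -> smooth_circle (W t)) -> smooth_circle v -> unif_deriv W v t ->
  is_derive (fun t => integral (W t)) t (integral v).
Proof.
intros J W v t HJ Ht HW Hv H. apply is_derive_Reals. intros eps Heps. assert (P := two_PI_pos).
destruct (H (eps / (2 * (2 * PI)))) as [d1 [Hd1 K1]]; [apply Rdiv_lt_0_compat; lra|].
destruct (open_step J t HJ Ht) as [d2 [Hd2 HJ2]].
assert (Hd : 0 < Rmin d1 d2) by now apply Rmin_pos.
exists (mkposreal _ Hd). intros h Hh0 Hh. simpl in Hh.
assert (Rmin d1 d2 <= d1) by apply Rmin_l. assert (Rmin d1 d2 <= d2) by apply Rmin_r.
assert (S1 := HW _ (HJ2 h ltac:(lra))). assert (S2 := HW _ Ht).
replace ((integral (W (t + h)) - integral (W t)) / h - integral v)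
  with (integral (fun x => (W (t + h) x - W t x) / h - v x)).
- apply Rle_lt_trans with (2 * PI * (eps / (2 * (2 * PI)))).
  + apply int_abs_bound; [now apply smooth_ex_int, smooth_quotient|]. intros x _. apply K1;
    auto; lra.
  + replace (2 * PI * (eps / (2 * (2 * PI)))) with (eps / 2) by (field; lra). lra.
- rewrite (int_ext _ (fun x => / h * (W (t + h) x - W t x) - v x)) by (intros; unfold Rdiv;
  ring).
  rewrite int_minus, int_scal, int_minus
    by auto using smooth_ex_int, smooth_minus, smooth_scal.
  unfold Rdiv; ring.
Qed.

Lemma flow_power_integral : forall J W W' t n, open J -> J t -> flow J W W' ->
  is_derive (fun t => integral (fun x => W t x ^ n)) t
    (integral (fun x => INR n * W t x ^ (n - 1) * W' t x)).
Proof.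
intros J W W' t n HJ Ht HF. assert (H := flow_unif _ _ _ t HF Ht). destruct HF as [H1 [H2 _]].
apply (unif_deriv_integral J (fun t x => W t x ^ n)); auto.
- intros; apply smooth_pow; auto.
- apply smooth_mult; auto. apply smooth_scal, smooth_pow; auto.
- apply unif_deriv_pow; auto.
Qed.

Lemma flow_energy : forall J W W' t, open J -> J t -> flow J W W' ->
  is_derive (fun t => L2sq (W t)) t (2 * integral (fun x => W t x * W' t x)).
Proof.
intros J W W' t HJ Ht HF. assert (H := flow_power_integral J W W' t 2 HJ Ht HF).
rewrite (int_ext _ (fun x => 2 * (W t x * W' t x))), int_scal in H.
- exact H.
- destruct HF as [H1 [H2 _]]. apply smooth_ex_int, smooth_mult; auto.
- intros x. simpl. ring.
Qed.

(** * Gronwall's inequality and sup bounds for transport equations *)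

(** Two-sided in time: y(t) e^(-Ct) does not increase to the right of 0, and
    y(t) e^(Ct) does not decrease to the left of it. *)
Lemma Gronwall : forall (I : R -> Prop) (y y' : R -> R) C,
  convex_set I -> I 0 ->
  (forall t, I t -> is_derive y t (y' t)) ->
  (forall t, I t -> Rabs (y' t) <= C * y t) ->
  forall t, I t -> y t <= exp (C * Rabs t) * y 0.
Proof.
intros I y y' C HI H0 Hd Hb t Ht.
assert (D : forall c z, I z -> is_derive (fun z => y z * exp (c * z)) z ((y' z + c * y z) *
  exp (c * z))).
{ intros c z Hz. evar_last.
  - apply (is_derive_mult y (fun z => exp (c * z)) z (y' z) (c * exp (c * z))).
    + now apply Hd.
    + auto_derive; auto. ring.
    + intros; apply Rmult_comm.
  - unfold plus, mult; simpl. ring. }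
assert (Cn : forall c z, I z -> continuity_pt (fun z => y z * exp (c * z)) z).
{ intros c z Hz. apply continuity_pt_filterlim.
  apply (@ex_derive_continuous R_AbsRing R_NormedModule (fun z => y z * exp (c * z)) z).
  eexists. exact (D c z Hz). }
destruct (Rle_dec 0 t) as [h|h].
- destruct (MVT_gen (fun z => y z * exp (- C * z)) 0 t (fun z => (y' z + - C * y z) * exp (- C * z))) as [c [Hc E]].
  + intros x Hx. rewrite Rmin_left, Rmax_right in Hx by lra. apply D, (HI 0 t); auto; lra.
  + intros x Hx. rewrite Rmin_left, Rmax_right in Hx by lra. apply Cn, (HI 0 t); auto; lra.
  + rewrite Rmin_left, Rmax_right in Hc by lra.
    assert (Ic : I c) by (apply (HI 0 t); auto; lra).
    specialize (Hb c Ic). apply Rabs_le_between in Hb.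
    assert (Ee := exp_pos (- C * c)).
    rewrite Rmult_0_r, exp_0 in E.
    assert (y t * exp (- C * t) <= y 0).
    { assert (0 <= (C * y c - y' c) * exp (- C * c) * t) by (repeat apply Rmult_le_pos;
      lra). nra. }
    rewrite Rabs_pos_eq by lra. assert (Et := exp_pos (C * t)).
    replace (y t) with (exp (C * t) * (y t * exp (- C * t))).
    * apply Rmult_le_compat_l; lra.
    * rewrite (Rmult_comm (y t)), <- Rmult_assoc, <- exp_plus.
      replace (C * t + - C * t) with 0 by ring. rewrite exp_0; ring.
- destruct (MVT_gen (fun z => y z * exp (C * z)) t 0 (fun z => (y' z + C * y z) * exp (C *
  z))) as [c [Hc E]].
  + intros x Hx. rewrite Rmin_left, Rmax_right in Hx by lra. apply D, (HI t 0); auto; lra.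
  + intros x Hx. rewrite Rmin_left, Rmax_right in Hx by lra. apply Cn, (HI t 0); auto; lra.
  + rewrite Rmin_left, Rmax_right in Hc by lra.
    assert (Ic : I c) by (apply (HI t 0); auto; lra).
    specialize (Hb c Ic). apply Rabs_le_between in Hb.
    assert (Ee := exp_pos (C * c)).
    rewrite Rmult_0_r, exp_0 in E.
    assert (y t * exp (C * t) <= y 0).
    { assert (0 <= (C * y c + y' c) * exp (C * c) * (- t)) by (repeat apply Rmult_le_pos;
      lra). nra. }
    rewrite Rabs_left by lra. assert (Et := exp_pos (C * - t)).
    replace (y t) with (exp (C * - t) * (y t * exp (C * t))).
    * apply Rmult_le_compat_l; lra.
    * rewrite (Rmult_comm (y t)), <- Rmult_assoc, <- exp_plus.
      replace (C * - t + C * t) with 0 by ring. rewrite exp_0; ring.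
Qed.

Lemma exp_monotone : forall x y, x <= y -> exp x <= exp y.
Proof. intros x y [H| ->]; [left; now apply exp_increasing|apply Rle_refl]. Qed.

(** If g were above some L > K on an interval of length d, then d L^p <= C K^p for all
    p, which fails for large p. *)
Lemma sup_of_powers : forall g C K, smooth_circle g -> (forall x, 0 <= g x) -> 0 < K ->
  (forall p, (1 <= p)%nat -> integral (fun x => g x ^ p) <= C * K ^ p) ->
  forall x, g x <= K.
Proof.
intros g C K Hg Hpos HK H x. assert (P := PI2_1).
destruct (periodic_reduce g x (proj1 Hg)) as [x0 [Hx0 <-]].
destruct (Rle_dec (g x0) K) as [h|h]; auto. exfalso.
set (L := (K + g x0) / 2).
assert (HL : K < L < g x0) by (unfold L; lra).
assert (HN : locally x0 (fun z => L < g z)).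
{ apply (smooth_continuous g x0 Hg (fun y => L < y)). apply (open_gt L (g x0)). lra. }
destruct HN as [d Hd].
assert (HD : exists a b, a < b /\ 0 <= a /\ b <= 2 * PI /\ forall z, a <= z <= b -> L < g z).
{ set (e := Rmin 1 (d / 2)). assert (Hdp := cond_pos d).
  assert (He : 0 < e) by (apply Rmin_pos; lra).
  assert (e <= 1) by apply Rmin_l. assert (e <= d / 2) by apply Rmin_r.
  destruct (Rle_dec x0 PI).
  - exists x0, (x0 + e). repeat split; try lra. intros z Hz. apply Hd.
    change (Rabs (z - x0) < d). apply Rabs_lt_between. lra.
  - exists (x0 - e), x0. repeat split; try lra. intros z Hz. apply Hd.
    change (Rabs (z - x0) < d). apply Rabs_lt_between. lra. }
destruct HD as [a [b [Hab [Ha [Hb Hz]]]]].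
assert (Q : forall p, (1 <= p)%nat -> (b - a) * L ^ p <= C * K ^ p).
{ intros p Hp. eapply Rle_trans; [|now apply H].
  assert (Sp := smooth_pow g p Hg).
  assert (Gp : forall z, 0 <= g z ^ p) by (intros; now apply pow_le).
  eapply Rle_trans; [|apply (RInt_sub_le_integral _ a b); auto; lra].
  replace ((b - a) * L ^ p) with (RInt (fun _ => L ^ p) a b).
  - apply RInt_le; [lra|apply ex_RInt_const| |].
    + apply (@ex_RInt_continuous R_CompleteNormedModule). intros;
      now apply (smooth_continuous (fun x => g x ^ p)).
    + intros z Hz'. apply pow_incr. specialize (Hz z ltac:(lra)). lra.
  - rewrite RInt_const. reflexivity. }
assert (HLK : 1 < L / K) by (apply Rmult_lt_reg_r with K; [lra|]; unfold Rdiv;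
  rewrite Rmult_assoc, Rinv_l; lra).
destruct (Pow_x_infinity (L / K)) with (b := C / (b - a) + 1) as [N HN].
{ rewrite Rabs_pos_eq; lra. }
specialize (HN (S N) ltac:(lia)). specialize (Q (S N) ltac:(lia)).
rewrite Rabs_pos_eq in HN by (apply pow_le; lra).
replace ((L / K) ^ S N) with (L ^ S N * / K ^ S N) in HN
  by (unfold Rdiv; rewrite Rpow_mult_distr, pow_inv; reflexivity).
assert (KN := pow_lt K (S N) HK).
apply Rge_le in HN. apply Rmult_le_compat_r with (r := (b - a) * K ^ S N) in HN; [|nra].
replace (L ^ S N * / K ^ S N * ((b - a) * K ^ S N)) with ((b - a) * L ^ S N) in HN by (field;
  lra).
replace ((C / (b - a) + 1) * ((b - a) * K ^ S N))
  with (C * K ^ S N + (b - a) * K ^ S N) in HN by (field; lra).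
nra.
Qed.

Lemma Derive_pow_fun : forall f n, smooth_circle f ->
  Derive (fun x => f x ^ n) = fun x => INR n * f x ^ (n - 1) * Derive f x.
Proof.
intros f n Hf. apply functional_extensionality; intros x.
rewrite Derive_pow by now apply smooth_ex_derive. replace (pred n) with (n - 1)%nat by lia.
ring.
Qed.

(** Integrating the transport term by parts, y_p = int r^(2p) satisfies
    y_p' = (1 - 2pb) int u_x r^(2p), so |y_p'| <= p c y_p with c independent of p. By
    Gronwall's inequality the p-th root of y_p is bounded uniformly in p, and p tends
    to infinity. *)
Lemma transport_sup : forall (J I : R -> Prop) u r r' b M T,
  open J -> convex_set I -> I 0 -> (forall t, I t -> J t) -> (forall t, I t -> Rabs t <= T) ->
  (forall t, J t -> smooth_circle (u t)) -> flow J r r' ->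
  (forall t x, J t -> r' t x = - u t x * Derive (r t) x - b * Derive (u t) x * r t x) ->
  (forall t x, I t -> Rabs (Derive (u t) x) <= M) ->
  exists K, forall t x, I t -> r t x ^ 2 <= K.
Proof.
intros J I u r r' b M T HJ HI H0 HIJ HT Hu HF Heq HM.
assert (HM0 : 0 <= M) by (eapply Rle_trans; [apply Rabs_pos|apply (HM 0 0 H0)]).
destruct HF as [S1 [S2 S3]]. assert (HF : flow J r r') by (split; [|split]; auto).
destruct (smooth_bounded _ (S1 0 (HIJ 0 H0))) as [B HB].
set (c := M * (1 + 2 * Rabs b)).
assert (Hc : 0 <= c) by (apply Rmult_le_pos; [auto|generalize (Rabs_pos b); lra]).
(* The summand 1 keeps the bound positive when r vanishes at time 0. *)
exists (exp (c * T) * (B ^ 2 + 1)). intros t x Ht.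
assert (Sr := S1 t (HIJ t Ht)).
apply (sup_of_powers (fun x => r t x ^ 2) (2 * PI)).
- now apply smooth_sqr.
- intros; apply pow2_ge_0.
- apply Rmult_lt_0_compat; [apply exp_pos|]. generalize (pow2_ge_0 B); lra.
- intros p Hp.
  set (y := fun t => integral (fun x => r t x ^ (2 * p))).
  set (y' := fun t => integral (fun x => INR (2 * p) * r t x ^ (2 * p - 1) * r' t x)).
  assert (Y : y t <= exp (INR p * c * Rabs t) * y 0).
  { apply (Gronwall I y y'); auto.
    - intros z Hz. apply (flow_power_integral J); auto.
    - intros z Hz. assert (Sz := S1 z (HIJ z Hz)). assert (Su := Hu z (HIJ z Hz)).
      assert (Sp := smooth_pow (r z) (2 * p) Sz). assert (Sux := smooth_Derive _ Su).
      assert (Par := int_parts (u z) (fun x => r z x ^ (2 * p)) Su Sp).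
      rewrite Derive_pow_fun in Par by auto.
      assert (E : y' z = (1 - INR (2 * p) * b) * integral (fun x => Derive (u z) x * r z x ^
        (2 * p))).
      { rewrite Rmult_minus_distr_r, Rmult_1_l. rewrite Par at 1.
        assert (Sa : smooth_circle (fun x => u z x * (INR (2 * p) * r z x ^ (2 * p - 1) *
          Derive (r z) x))).
        { apply smooth_mult; auto. apply smooth_mult;
          [apply smooth_scal, smooth_pow|apply smooth_Derive]; auto. }
        assert (Sb := smooth_mult _ _ Sux Sp).
        replace (- integral (fun x => u z x * (INR (2 * p) * r z x ^ (2 * p - 1) * Derive (r
          z) x)))
          with (-1 * integral (fun x => u z x * (INR (2 * p) * r z x ^ (2 * p - 1) * Derive (r
            z) x))) by ring.
        rewrite <- !int_scal, <- int_minus by auto using smooth_ex_int, smooth_scal.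
        apply int_ext. intros s. rewrite Heq by auto.
        replace (r z s ^ (2 * p)) with (r z s * r z s ^ (2 * p - 1)).
        - ring.
        - replace (2 * p)%nat with (S (2 * p - 1)) at 2 by lia. reflexivity. }
      rewrite E, Rabs_mult.
      assert (A1 : Rabs (integral (fun x => Derive (u z) x * r z x ^ (2 * p))) <= M * y z).
      { unfold y. rewrite <- int_scal by auto using smooth_ex_int.
        apply int_abs; auto using smooth_ex_int, smooth_scal, smooth_mult.
        intros s. rewrite Rabs_mult, (Rabs_pos_eq (r z s ^ (2 * p))).
        - apply Rmult_le_compat_r; auto. rewrite pow_mult. apply pow_le, pow2_ge_0.
        - rewrite pow_mult. apply pow_le, pow2_ge_0. }
      assert (A2 : Rabs (1 - INR (2 * p) * b) <= INR p * (1 + 2 * Rabs b)).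
      { assert (1 <= INR p) by (apply (le_INR 1); auto). rewrite mult_INR. simpl (INR 2).
        eapply Rle_trans; [apply Rabs_triang|]. rewrite Rabs_R1, Rabs_Ropp, !Rabs_mult.
        rewrite (Rabs_pos_eq (1 + 1)), (Rabs_pos_eq (INR p)) by lra. generalize (Rabs_pos b).
        nra. }
      unfold c. replace (INR p * (M * (1 + 2 * Rabs b)) * y z)
        with ((INR p * (1 + 2 * Rabs b)) * (M * y z)) by ring.
      apply Rmult_le_compat; auto using Rabs_pos. }
  assert (Y0 : y 0 <= 2 * PI * (B ^ 2) ^ p).
  { rewrite <- int_const. assert (S0 := S1 0 (HIJ 0 H0)).
    apply int_le; [apply smooth_ex_int, smooth_pow; auto|apply smooth_ex_int, smooth_const|].
    intros s. rewrite pow_mult. apply pow_incr. split; [apply pow2_ge_0|].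
    apply pow_maj_Rabs, HB. }
  rewrite (int_ext _ (fun x => r t x ^ (2 * p))) by (intros; now rewrite pow_mult).
  change (y t <= 2 * PI * (exp (c * T) * (B ^ 2 + 1)) ^ p).
  eapply Rle_trans; [exact Y|]. rewrite Rpow_mult_distr.
  apply Rle_trans with (exp (c * T) ^ p * (2 * PI * (B ^ 2) ^ p)).
  + apply Rmult_le_compat; [left; apply exp_pos| | |exact Y0].
    * unfold y. replace 0 with (integral (fun _ => 0)) at 1 by (rewrite int_const; ring).
      apply int_le; [apply smooth_ex_int, smooth_const|apply smooth_ex_int, smooth_pow; auto|].
      intros s. rewrite pow_mult. apply pow_le, pow2_ge_0.
    * rewrite <- Rpower_pow by apply exp_pos. unfold Rpower. rewrite ln_exp.
      apply exp_monotone. rewrite !Rmult_assoc. apply Rmult_le_compat_l; [apply pos_INR|].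
      apply Rmult_le_compat_l; auto.
  + replace (exp (c * T) ^ p * (2 * PI * (B ^ 2) ^ p))
    with (2 * PI * (exp (c * T) ^ p * (B ^ 2) ^ p)) by ring.
    apply Rmult_le_compat_l; [left; apply two_PI_pos|].
    apply Rmult_le_compat_l; [apply pow_le; left; apply exp_pos|].
    apply pow_incr. generalize (pow2_ge_0 B); lra.
Qed.

(** * Energy estimates *)

(** E is the energy under study, or the constant 1 for a quantity that is already known
    to be bounded on I; C must serve all times in I. *)
Definition L2_controlled (I : R -> Prop) (E : R -> R) (F : R -> R -> R) : Prop :=
  (forall t, I t -> smooth_circle (F t)) /\
  exists C, forall t, I t -> L2sq (F t) <= C * E t.

Definition sup_controlled (I : R -> Prop) (E : R -> R) (F : R -> R -> R) : Prop :=
  (forall t, I t -> smooth_circle (F t)) /\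
  exists C, forall t x, I t -> F t x ^ 2 <= C * E t.

Definition one (_ : R) : R := 1.

Lemma L2_controlled_ext : forall I E F G, (forall t x, I t -> F t x = G t x) ->
  L2_controlled I E F -> L2_controlled I E G.
Proof.
intros I E F G H [HS [C HC]].
assert (e : forall t, I t -> F t = G t) by (intros; apply functional_extensionality; auto).
split.
- intros t Ht. rewrite <- e; auto.
- exists C. intros t Ht. rewrite <- e; auto.
Qed.

Lemma L2_controlled_plus : forall I E F G, L2_controlled I E F -> L2_controlled I E G ->
  L2_controlled I E (fun t x => F t x + G t x).
Proof.
intros I E F G [HF [C1 H1]] [HG [C2 H2]]. split.
- intros; apply smooth_plus; auto.
- exists (2 * C1 + 2 * C2). intros t Ht.
  eapply Rle_trans; [apply L2sq_plus; auto|]. specialize (H1 t Ht). specialize (H2 t Ht). lra.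
Qed.

Lemma L2_controlled_scal : forall I E c F, L2_controlled I E F ->
  L2_controlled I E (fun t x => c * F t x).
Proof.
intros I E c F [HF [C H]]. split.
- intros; apply smooth_scal; auto.
- exists (c ^ 2 * C). intros t Ht. rewrite L2sq_scal by auto. rewrite Rmult_assoc.
  apply Rmult_le_compat_l; [apply pow2_ge_0|auto].
Qed.

Lemma L2_controlled_minus : forall I E F G, L2_controlled I E F -> L2_controlled I E G ->
  L2_controlled I E (fun t x => F t x - G t x).
Proof.
intros I E F G HF HG. apply L2_controlled_ext with (fun t x => F t x + -1 * G t x).
- intros; ring.
- now apply L2_controlled_plus, L2_controlled_scal.
Qed.

Lemma L2_controlled_weaken : forall I E F, (forall t, I t -> 1 <= E t) ->
  L2_controlled I one F -> L2_controlled I E F.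
Proof.
intros I E F HE [HF [C H]]. split; auto. exists C. intros t Ht.
specialize (H t Ht). unfold one in H. generalize (HE t Ht) (L2sq_nonneg _ (HF t Ht)). nra.
Qed.

Lemma sup_controlled_L2 : forall I E F, sup_controlled I E F -> L2_controlled I E F.
Proof.
intros I E F [HF [C H]]. split; auto. exists (2 * PI * C). intros t Ht.
rewrite Rmult_assoc, <- int_const. apply int_le.
- apply smooth_ex_int, smooth_sqr; auto.
- apply smooth_ex_int, smooth_const.
- intros x; auto.
Qed.

Lemma L2_controlled_sup : forall I E F, L2_controlled I E F ->
  L2_controlled I E (fun t => Derive (F t)) -> sup_controlled I E F.
Proof.
intros I E F [HF [C1 H1]] [_ [C2 H2]]. split; auto. exists (2 * (C1 + C2)). intros t x Ht.
eapply Rle_trans; [apply sup_le_L2sq; auto|]. specialize (H1 t Ht). specialize (H2 t Ht). lra.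
Qed.

Lemma L2_controlled_sup_mult : forall I E F G, sup_controlled I one F -> L2_controlled I E G ->
  L2_controlled I E (fun t x => F t x * G t x).
Proof.
intros I E F G [HF [C1 H1]] [HG [C2 H2]]. split; [intros; apply smooth_mult; auto|].
exists (C1 * C2). intros t Ht. unfold one in H1.
assert (0 <= C1) by (generalize (H1 t 0 Ht) (pow2_ge_0 (F t 0)); lra).
eapply Rle_trans; [apply (L2sq_mult_sup _ _ C1); auto|].
- intros x. generalize (H1 t x Ht); lra.
- rewrite Rmult_assoc. apply Rmult_le_compat_l; auto.
Qed.

Lemma L2_controlled_mult_sup : forall I E F G, L2_controlled I one F -> sup_controlled I E G ->
  L2_controlled I E (fun t x => F t x * G t x).
Proof.
intros I E F G [HF [C1 H1]] [HG [C2 H2]]. split; [intros; apply smooth_mult; auto|].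
exists (C2 * C1). intros t Ht. unfold one in H1.
assert (0 <= C2 * E t) by (generalize (H2 t 0 Ht) (pow2_ge_0 (G t 0)); lra).
replace (fun x => F t x * G t x) with (fun x => G t x * F t x)
  by (apply functional_extensionality; intros; ring).
eapply Rle_trans; [apply (L2sq_mult_sup _ _ (C2 * E t)); auto|].
replace (C2 * C1 * E t) with (C2 * E t * C1) by ring.
apply Rmult_le_compat_l; auto. specialize (H1 t Ht); lra.
Qed.

(** Leibniz' rule with the term F D^n G removed. The induction uses only
    D^(n+1) (F G) = D^n (F G') + D^n (F' G), so that binomial coefficients stay hidden
    in the constants. *)
Lemma L2_controlled_commutator : forall I E n F G,
  (forall t, I t -> 0 <= E t) ->
  (forall t, I t -> smooth_circle (F t)) -> (forall t, I t -> smooth_circle (G t)) ->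
  (forall i, (1 <= i <= n)%nat ->
     L2_controlled I E (fun t x => Derive_n (F t) i x * Derive_n (G t) (n - i) x)) ->
  L2_controlled I E (fun t x => Derive_n (fun y => F t y * G t y) n x - F t x * Derive_n (G t)
    n x).
Proof.
intros I E n F G HE; revert F G. induction n as [|n IH]; intros F G HF HG H.
- apply L2_controlled_ext with (fun _ _ => 0); [intros; simpl; ring|].
  split; [intros; apply smooth_const|]. exists 0. intros t Ht.
  unfold L2sq. rewrite int_const. right; ring.
- assert (HF' : forall t, I t -> smooth_circle (Derive (F t))) by (intros;
  apply smooth_Derive; auto).
  assert (HG' : forall t, I t -> smooth_circle (Derive (G t))) by (intros;
    apply smooth_Derive; auto).
  apply L2_controlled_ext with (fun t x =>
    (Derive_n (fun y => F t y * Derive (G t) y) n x - F t x * Derive_n (Derive (G t)) n x) +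
    ((Derive_n (fun y => Derive (F t) y * G t y) n x - Derive (F t) x * Derive_n (G t) n x) +
     Derive (F t) x * Derive_n (G t) n x)).
  + intros t x Ht. rewrite (Derive_n_S_fun (fun y => F t y * G t y)).
    rewrite Derive_mult_fun, Derive_n_plus_fun by (try apply smooth_mult; auto).
    rewrite (Derive_n_S_fun (G t)). ring.
  + apply L2_controlled_plus; [|apply L2_controlled_plus].
    * apply (IH F (fun t => Derive (G t))); auto. intros i Hi.
      apply L2_controlled_ext with (2 := H i ltac:(lia)). intros t x Ht.
      rewrite Derive_n_Derive. now replace (S n - i)%nat with (S (n - i)) by lia.
    * apply (IH (fun t => Derive (F t)) G); auto. intros i Hi.
      apply L2_controlled_ext with (2 := H (S i) ltac:(lia)). intros t x Ht.
      now rewrite Derive_n_Derive.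
    * apply L2_controlled_ext with (2 := H 1%nat ltac:(lia)). intros t x Ht.
      now replace (S n - 1)%nat with n by lia.
Qed.

Lemma L2_controlled_product : forall I E n F G,
  (forall t, I t -> 0 <= E t) ->
  (forall t, I t -> smooth_circle (F t)) -> (forall t, I t -> smooth_circle (G t)) ->
  (forall i, (i <= n)%nat ->
     L2_controlled I E (fun t x => Derive_n (F t) i x * Derive_n (G t) (n - i) x)) ->
  L2_controlled I E (fun t x => Derive_n (fun y => F t y * G t y) n x).
Proof.
intros I E n F G HE HF HG H.
apply L2_controlled_ext with (fun t x =>
  (Derive_n (fun y => F t y * G t y) n x - F t x * Derive_n (G t) n x) + F t x * Derive_n (G
    t) n x).
- intros; ring.
- apply L2_controlled_plus.
  + apply L2_controlled_commutator; auto. intros; apply H; lia.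
  + apply L2_controlled_ext with (2 := H 0%nat ltac:(lia)). intros. now rewrite Nat.sub_0_r.
Qed.

(** The transport term costs no derivative, since 2 int W u W_x = - int u_x W^2. *)
Lemma transport_energy : forall (I : R -> Prop) E u W W' P M,
  (forall t, I t -> smooth_circle (u t)) ->
  (forall t x, I t -> Rabs (Derive (u t) x) <= M) ->
  L2_controlled I E W -> L2_controlled I E P ->
  (forall t x, I t -> W' t x = - u t x * Derive (W t) x + P t x) ->
  exists C, forall t, I t -> Rabs (2 * integral (fun x => W t x * W' t x)) <= C * E t.
Proof.
intros I E u W W' P M Hu HM [HW [C1 H1]] [HP [C2 H2]] HEq.
exists (Rabs M * C1 + C1 + C2). intros t Ht.
specialize (HW t Ht). specialize (HP t Ht). specialize (Hu t Ht). specialize (H1 t Ht).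
specialize (H2 t Ht).
assert (Hu' := smooth_Derive _ Hu). assert (HW' := smooth_Derive _ HW).
assert (S2 := smooth_sqr _ HW). assert (SP := smooth_mult _ _ HW HP).
assert (Par := int_parts _ _ Hu S2). rewrite Derive_pow_fun in Par by auto.
assert (SW : smooth_circle (fun x => W t x * W' t x)).
{ replace (W' t) with (fun x => - u t x * Derive (W t) x + P t x)
    by (apply functional_extensionality; intros; now rewrite HEq).
  apply smooth_mult, smooth_plus; auto. apply smooth_mult; auto. now apply smooth_opp. }
assert (E1 : 2 * integral (fun x => W t x * W' t x) =
   integral (fun x => Derive (u t) x * W t x ^ 2) + 2 * integral (fun x => W t x * P t x)).
{ assert (S3 : smooth_circle (fun x => u t x * (INR 2 * W t x ^ (2 - 1) * Derive (W t) x))).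
  { apply smooth_mult; auto. apply smooth_mult;
    auto. apply smooth_scal. now apply smooth_pow. }
  rewrite Par.
  replace (- integral (fun x => u t x * (INR 2 * W t x ^ (2 - 1) * Derive (W t) x)))
    with (-1 * integral (fun x => u t x * (INR 2 * W t x ^ (2 - 1) * Derive (W t) x))) by ring.
  rewrite <- !int_scal, <- int_plus by auto using smooth_ex_int, smooth_scal.
  apply int_ext. intros x. rewrite HEq by auto. simpl. ring. }
rewrite E1. eapply Rle_trans; [apply Rabs_triang|].
assert (A1 : Rabs (integral (fun x => Derive (u t) x * W t x ^ 2)) <= Rabs M * L2sq (W t)).
{ unfold L2sq. rewrite <- int_scal by auto using smooth_ex_int.
  apply int_abs; auto using smooth_ex_int, smooth_mult, smooth_scal.
  intros x. rewrite Rabs_mult, (Rabs_pos_eq (_ ^ 2)) by apply pow2_ge_0.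
  apply Rmult_le_compat_r; [apply pow2_ge_0|]. eapply Rle_trans; [apply HM;
    auto|apply Rle_abs]. }
assert (A2 := int_mult_abs _ _ HW HP).
rewrite (Rabs_mult 2), (Rabs_pos_eq 2) by lra.
assert (Rabs M * L2sq (W t) <= Rabs M * (C1 * E t)) by (apply Rmult_le_compat_l;
  [apply Rabs_pos|auto]).
lra.
Qed.

(** The induction on k. The lower orders give sup bounds on D^j u for 1 <= j <= k and on
    D^j r for j < k, and L2 bounds one order higher. The energy E controls
    D^(k+2) u, D^k m and D^(k+1) r in L2, and one order lower in sup. In every product
    that remains after removing the transport terms, the orders of the factors add up
    to a number for which one factor is bounded, in one of the two norms, and the other
    is controlled by E in the other norm. Hence |E'| <= C E. For k = 0 the bounds come
    from the hypothesis on u_x and from transport_sup. *)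
Lemma regularity_induction : forall (J I : R -> Prop) u m m' r r' alpha a kappa M T,
  open J -> convex_set I -> I 0 -> (forall t, I t -> J t) -> (forall t, I t -> Rabs t <= T) ->
  (forall t, J t -> smooth_circle (u t)) -> flow J m m' -> flow J r r' ->
  (forall t x, J t -> m' t x = alpha * Derive (u t) x - a * Derive (u t) x * m t x
         - u t x * Derive (m t) x - kappa * r t x * Derive (r t) x) ->
  (forall t x, J t -> r' t x = - u t x * Derive (r t) x - (a - 1) * Derive (u t) x * r t x) ->
  (forall t j, J t -> L2sq (Derive_n (u t) (j + 2)) <= L2sq (Derive_n (m t) j)) ->
  (forall t x, I t -> Rabs (Derive (u t) x) <= M) ->
  sup_controlled I one r /\
  forall k, L2_controlled I one (fun t => Derive_n (m t) k) /\
    L2_controlled I one (fun t => Derive_n (r t) (S k)).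
Proof.
intros J I u m m' r r' alpha a kappa M T HJ HI H0 HIJ HT Hu Fm Fr Hm Hr Ell HM.
assert (Sm : forall t, J t -> smooth_circle (m t)) by apply Fm.
assert (Sr : forall t, J t -> smooth_circle (r t)) by apply Fr.
assert (Su : forall j t, I t -> smooth_circle (Derive_n (u t) j)) by (intros;
  apply smooth_Derive_n; auto).
assert (Smi : forall j t, I t -> smooth_circle (Derive_n (m t) j)) by (intros;
  apply smooth_Derive_n; auto).
assert (Sri : forall j t, I t -> smooth_circle (Derive_n (r t) j)) by (intros;
  apply smooth_Derive_n; auto).
assert (Fr0 : sup_controlled I one r).
{ split; auto. destruct (transport_sup J I u r r' (a - 1) M T) as [K HK]; auto.
  exists K. intros. unfold one. rewrite Rmult_1_r. auto. }
split; [exact Fr0|]. intros k.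
induction k as [k IH] using (well_founded_induction lt_wf).
set (E := fun t => 1 + L2sq (Derive_n (m t) k) + L2sq (Derive_n (r t) (S k))).
assert (HE : forall t, I t -> 1 <= E t).
{ intros t Ht. unfold E. generalize (L2sq_nonneg _ (Smi k t Ht)) (L2sq_nonneg _ (Sri (S k) t
  Ht)). lra. }
assert (HE0 : forall t, I t -> 0 <= E t) by (intros t Ht; specialize (HE t Ht); lra).
(* Prefixes of the bounds below: b bounded in L2, s bounded in sup, e controlled by E
   in L2, se controlled by E in sup. *)
assert (ell : forall w j, L2_controlled I w (fun t => Derive_n (m t) j) ->
  L2_controlled I w (fun t => Derive_n (u t) (j + 2))).
{ intros w j [_ [C HC]]. split; [apply Su|]. exists C. intros t Ht.
  eapply Rle_trans; [apply Ell; auto|auto]. }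
assert (s_u1 : sup_controlled I one (fun t => Derive_n (u t) 1)).
{ split; [apply Su|]. exists (M ^ 2). intros t x Ht. unfold one. rewrite Rmult_1_r.
  apply pow_maj_Rabs. now apply HM. }
assert (b_m : forall j, (j < k)%nat ->
  L2_controlled I one (fun t => Derive_n (m t) j)) by (intros; now apply IH).
assert (b_u : forall j, (1 <= j <= k + 1)%nat ->
  L2_controlled I one (fun t => Derive_n (u t) j)).
{ intros j Hj. destruct (Nat.eq_dec j 1) as [->|Hj1]; [now apply sup_controlled_L2|].
  replace j with ((j - 2) + 2)%nat by lia. apply ell, b_m. lia. }
assert (s_u : forall j, (1 <= j)%nat -> (j = 1 \/ j <= k)%nat ->
  sup_controlled I one (fun t => Derive_n (u t) j)).
{ intros j Hj1 Hj. destruct (Nat.eq_dec j 1) as [->|Hj2]; [exact s_u1|].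
  apply L2_controlled_sup; [apply b_u; lia|]. apply (b_u (S j)). lia. }
assert (e_m : forall j, (j <= k)%nat -> L2_controlled I E (fun t => Derive_n (m t) j)).
{ intros j Hj. destruct (Nat.eq_dec j k) as [->|Hj1].
  - split; [apply Smi|]. exists 1. intros t Ht. unfold E.
    generalize (L2sq_nonneg _ (Sri (S k) t Ht)); lra.
  - apply L2_controlled_weaken; auto. apply b_m; lia. }
assert (e_u : forall j, (1 <= j <= k + 2)%nat ->
  L2_controlled I E (fun t => Derive_n (u t) j)).
{ intros j Hj. destruct (Nat.eq_dec j (k + 2)) as [->|Hj1]; [apply ell, e_m; lia|].
  apply L2_controlled_weaken; auto. apply b_u; lia. }
assert (se_m : forall j, (j < k)%nat -> sup_controlled I E (fun t => Derive_n (m t) j)).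
{ intros j Hj. apply L2_controlled_sup; [apply e_m; lia|]. apply (e_m (S j)); lia. }
assert (b_r : forall j, (j <= k)%nat -> L2_controlled I one (fun t => Derive_n (r t) j)).
{ intros [|j] Hj; [now apply sup_controlled_L2|]. apply IH; lia. }
assert (e_r : forall j, (j <= k + 1)%nat -> L2_controlled I E (fun t => Derive_n (r t) j)).
{ intros j Hj. destruct (Nat.eq_dec j (k + 1)) as [->|Hj1].
  - split; [apply Sri|]. exists 1. intros t Ht. unfold E. rewrite Nat.add_1_r.
    generalize (L2sq_nonneg _ (Smi k t Ht)); lra.
  - apply L2_controlled_weaken; auto. apply b_r; lia. }
assert (s_r : forall j, (j = 0 \/ j + 1 <= k)%nat ->
  sup_controlled I one (fun t => Derive_n (r t) j)).
{ intros j Hj. destruct (Nat.eq_dec j 0) as [->|Hj1]; [exact Fr0|].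
  apply L2_controlled_sup; [apply b_r; lia|]. apply (b_r (S j)). lia. }
assert (se_r : forall j, (j <= k)%nat -> sup_controlled I E (fun t => Derive_n (r t) j)).
{ intros j Hj. apply L2_controlled_sup; [apply e_r; lia|]. apply (e_r (S j)); lia. }
assert (SuI : forall t, I t -> smooth_circle (u t)) by auto.
assert (SmI : forall t, I t -> smooth_circle (m t)) by auto.
assert (SrI : forall t, I t -> smooth_circle (r t)) by auto.
assert (SuxI : forall t, I t -> smooth_circle (Derive (u t))) by (intros; apply smooth_Derive;
  auto).
assert (SmxI : forall t, I t -> smooth_circle (Derive (m t))) by (intros; apply smooth_Derive;
  auto).
assert (SrxI : forall t, I t -> smooth_circle (Derive (r t))) by (intros; apply smooth_Derive;
  auto).
(* The factor D^i u has i >= 1, because u D^k m_x belongs to the transport term. *)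
assert (Q1 : L2_controlled I E (fun t x => Derive_n (fun y => u t y * Derive (m t) y) k x - u
  t x * Derive_n (Derive (m t)) k x)).
{ apply (L2_controlled_commutator I E k u (fun t => Derive (m t))); auto. intros i Hi.
  apply L2_controlled_ext with (fun t x => Derive_n (u t) i x * Derive_n (m t) (S (k - i)) x).
  - intros. now rewrite Derive_n_Derive.
  - apply L2_controlled_sup_mult; [apply s_u; lia|apply e_m; lia]. }
assert (Q2 : L2_controlled I E (fun t x => Derive_n (fun y => Derive (u t) y * m t y) k x)).
{ apply (L2_controlled_product I E k (fun t => Derive (u t)) m); auto. intros i Hi.
  apply L2_controlled_ext with (fun t x => Derive_n (u t) (S i) x * Derive_n (m t) (k - i) x).
  - intros. now rewrite Derive_n_Derive.
  - destruct (Nat.eq_dec i 0); [|destruct (Nat.eq_dec i k)].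
    + apply L2_controlled_sup_mult; [apply s_u; lia|apply e_m; lia].
    + apply L2_controlled_mult_sup; [apply b_u; lia|apply se_m; lia].
    + apply L2_controlled_sup_mult; [apply s_u; lia|apply e_m; lia]. }
assert (Q3 : L2_controlled I E (fun t x => Derive_n (fun y => r t y * Derive (r t) y) k x)).
{ apply (L2_controlled_product I E k r (fun t => Derive (r t))); auto. intros i Hi.
  apply L2_controlled_ext with (fun t x => Derive_n (r t) i x * Derive_n (r t) (S (k - i)) x).
  - intros. now rewrite Derive_n_Derive.
  - destruct (Nat.eq_dec i 0); [|destruct (Nat.eq_dec i k)].
    + apply L2_controlled_sup_mult; [apply s_r; lia|apply e_r; lia].
    + apply L2_controlled_mult_sup; [apply b_r; lia|apply se_r; lia].
    + apply L2_controlled_sup_mult; [apply s_r; lia|apply e_r; lia]. }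
assert (Q4 : L2_controlled I E (fun t x => Derive_n (Derive (u t)) k x)).
{ apply L2_controlled_ext with (fun t => Derive_n (u t) (S k)); [intros;
  now rewrite Derive_n_Derive|].
  apply e_u; lia. }
assert (Q5 : L2_controlled I E (fun t x => Derive_n (fun y => u t y * Derive (r t) y) (S k) x - u t x * Derive_n (Derive (r t)) (S k) x)).
{ apply (L2_controlled_commutator I E (S k) u (fun t => Derive (r t))); auto. intros i Hi.
  apply L2_controlled_ext with (fun t x => Derive_n (u t) i x * Derive_n (r t) (S (S k - i))
    x).
  - intros. now rewrite Derive_n_Derive.
  - destruct (Nat.eq_dec i 1); [|destruct (Nat.eq_dec i (S k))].
    + apply L2_controlled_sup_mult; [apply s_u; lia|apply e_r; lia].
    + apply L2_controlled_mult_sup; [apply b_u; lia|apply se_r; lia].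
    + apply L2_controlled_sup_mult; [apply s_u; lia|apply e_r; lia]. }
(* For i = S k the top derivative D^(k+2) u meets r itself, which is bounded in sup. *)
assert (Q6 : L2_controlled I E (fun t x => Derive_n (fun y => Derive (u t) y * r t y) (S k)
  x)).
{ apply (L2_controlled_product I E (S k) (fun t => Derive (u t)) r); auto. intros i Hi.
  apply L2_controlled_ext with (fun t x => Derive_n (u t) (S i) x * Derive_n (r t) (S k - i)
    x).
  - intros. now rewrite Derive_n_Derive.
  - destruct (Nat.eq_dec i (S k)); [|destruct (Nat.eq_dec i 0); [|destruct (Nat.eq_dec i k)]].
    + apply L2_controlled_ext with (fun t x => Derive_n (r t) (S k - i) x * Derive_n (u t) (S
      i) x); [intros; ring|].
      apply L2_controlled_sup_mult; [apply s_r; lia|apply e_u; lia].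
    + apply L2_controlled_sup_mult; [apply s_u; lia|apply e_r; lia].
    + apply L2_controlled_mult_sup; [apply b_u; lia|apply se_r; lia].
    + apply L2_controlled_sup_mult; [apply s_u; lia|apply e_r; lia]. }
destruct (transport_energy I E u (fun t => Derive_n (m t) k) (fun t => Derive_n (m' t) k)
  (fun t x => ((alpha * Derive_n (Derive (u t)) k x - a * Derive_n (fun y => Derive (u t) y *
    m t y) k x)
    - (Derive_n (fun y => u t y * Derive (m t) y) k x - u t x * Derive_n (Derive (m t)) k x))
    - kappa * Derive_n (fun y => r t y * Derive (r t) y) k x) M) as [C1 K1]; auto.
{ apply L2_controlled_minus; [apply L2_controlled_minus; [apply L2_controlled_minus|]|];
  auto using L2_controlled_scal. }
{ intros t x Ht.
  replace (m' t) with (fun x => alpha * Derive (u t) x - a * (Derive (u t) x * m t x)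
    - u t x * Derive (m t) x - kappa * (r t x * Derive (r t) x))
    by (apply functional_extensionality; intros; rewrite Hm by auto; ring).
  rewrite !Derive_n_minus_fun, !Derive_n_scal_fun
    by auto 6 using smooth_minus, smooth_scal, smooth_mult.
  rewrite (Derive_n_Derive (m t)). cbn [Derive_n]. ring. }
destruct (transport_energy I E u (fun t => Derive_n (r t) (S k)) (fun t => Derive_n (r' t) (S
  k))
  (fun t x => - 1 * (Derive_n (fun y => u t y * Derive (r t) y) (S k) x - u t x * Derive_n
    (Derive (r t)) (S k) x)
    - (a - 1) * Derive_n (fun y => Derive (u t) y * r t y) (S k) x) M) as [C2 K2]; auto.
{ apply e_r; lia. }
{ apply L2_controlled_minus; auto using L2_controlled_scal. }
{ intros t x Ht.
  replace (r' t) with (fun x => - 1 * (u t x * Derive (r t) x) - (a - 1) * (Derive (u t) x * r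
    t x))
    by (apply functional_extensionality; intros; rewrite Hr by auto; ring).
  rewrite !Derive_n_minus_fun, !Derive_n_scal_fun
    by auto 6 using smooth_minus, smooth_scal, smooth_mult.
  rewrite (Derive_n_Derive (r t)).
  change (Derive (Derive_n (r t) (S k)) x) with (Derive_n (r t) (S (S k)) x). ring. }
set (E' := fun t => 2 * integral (fun x => Derive_n (m t) k x * Derive_n (m' t) k x) +
  2 * integral (fun x => Derive_n (r t) (S k) x * Derive_n (r' t) (S k) x)).
assert (G : forall t, I t -> E t <= exp ((C1 + C2) * Rabs t) * E 0).
{ apply (Gronwall I E E'); auto.
  - intros t Ht.
    assert (D1 := flow_energy _ _ _ t HJ (HIJ t Ht) (flow_Derive_n _ _ _ k Fm)).
    assert (D2 := flow_energy _ _ _ t HJ (HIJ t Ht) (flow_Derive_n _ _ _ (S k) Fr)).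
    assert (D3 := is_derive_plus _ _ t _ _ (is_derive_plus _ _ t _ _ (is_derive_const 1 t) D1)
      D2).
    unfold E, E'. evar_last; [exact D3|]. unfold plus, zero; simpl. ring.
  - intros t Ht. unfold E'. eapply Rle_trans; [apply Rabs_triang|].
    specialize (K1 t Ht). specialize (K2 t Ht). lra. }
set (C := exp (Rabs (C1 + C2) * T) * E 0).
assert (G' : forall t, I t -> E t <= C).
{ intros t Ht. eapply Rle_trans; [apply G; auto|]. unfold C.
  apply Rmult_le_compat_r; [auto|]. apply exp_monotone.
  apply Rle_trans with (Rabs (C1 + C2) * Rabs t).
  - apply Rmult_le_compat_r; [apply Rabs_pos|apply Rle_abs].
  - apply Rmult_le_compat_l; [apply Rabs_pos|auto]. }
split; (split; [auto|]); exists C; intros t Ht; specialize (G' t Ht); unfold E in G';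
  unfold one;
generalize (L2sq_nonneg _ (Smi k t Ht)) (L2sq_nonneg _ (Sri (S k) t Ht)); lra.
Qed.

(** * The theorem *)

Lemma Aop_multiplier : forall s f,
  Aop s f = multiplier (fun n => Rpower (1 + IZR n ^ 2) s) f.
Proof.
intros s f. apply functional_extensionality; intros x. unfold Aop, multiplier. do 2 f_equal.
apply functional_extensionality; intros n. unfold multiplier_term. f_equal.
unfold fourier_coef, expi, Cmult, cos_coef, sin_coef, integral, cosn, sinn. simpl. ring.
Qed.

Lemma Aop_weight : forall s, 1 < s ->
  (exists q, admissible (fun n => Rpower (1 + IZR n ^ 2) s) q) /\
  forall n : Z, IZR n ^ 2 <= Rpower (1 + IZR n ^ 2) s.
Proof.
intros s Hs.
assert (B : forall n : Z, 1 <= 1 + IZR n ^ 2) by (intros n; generalize (pow2_ge_0 (IZR n));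
  lra).
split.
- exists (Z.to_nat (up s)). split.
  + intros n. specialize (B n). rewrite Rabs_pos_eq by (left; apply exp_pos).
    rewrite <- (Rpower_pow (Z.to_nat (up s)) (1 + IZR n ^ 2)) by lra. apply Rle_Rpower; auto.
    destruct (archimed s) as [A1 _]. rewrite INR_IZR_INZ, Z2Nat.id; [lra|].
    apply le_IZR. lra.
  + intros n. do 2 f_equal. rewrite opp_IZR. ring.
- intros n. specialize (B n). apply Rle_trans with (Rpower (1 + IZR n ^ 2) 1).
  + rewrite Rpower_1 by lra. lra.
  + apply Rle_Rpower; lra.
Qed.

Theorem lemma3p2 :
  forall (s a kappa alpha : R) (J : R -> Prop) (u rho : R -> R -> R),
    1 < s -> a <> 1 ->
    maximal_solution s a kappa J u rho (fun _ => alpha) ->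
    bounded_on_bounded_subintervals J (fun t => supnorm (Derive (u t))) ->
    forall k : nat,
      bounded_on_bounded_subintervals J (fun t =>
        Rbar_plus (Rbar_sqr (sobolev_norm k (Aop s (u t))))
                  (Rbar_sqr (sobolev_norm (S k) (rho t)))).
Proof.
intros s a kappa alpha J u rho Hs _ [[HJo HJc] [HJ0 [Hsol _]]] Hux k I0 [_ [HI0J [T HT]]].
destruct Hsol as [Hu Hrho Hm Hr _]. cbv zeta in Hm.
destruct (Aop_weight s Hs) as [[q Hw] Hlow].
set (w := fun n : Z => Rpower (1 + IZR n ^ 2) s) in *.
set (m := fun t => multiplier w (u t)).
assert (HA : (fun t => Aop s (u t)) = m).
{ apply functional_extensionality; intros t. apply Aop_multiplier. }
destruct (smooth_curve_flow J u HJo Hu) as [v Fu].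
destruct (smooth_curve_flow J rho HJo Hrho) as [r' Fr].
assert (Fm := flow_multiplier J w q u v HJo Hw Fu).
assert (Su : forall t, J t -> smooth_circle (u t)) by apply Fu.
(* The hull of I0 and 0, since Gronwall's inequality starts from time 0. *)
set (I := fun t => t = 0 \/ exists t1, I0 t1 /\ (0 <= t <= t1 \/ t1 <= t <= 0)).
assert (HI0 : forall t, I0 t -> I t).
{ intros t Ht. right. exists t. split; auto. destruct (Rle_dec 0 t); lra. }
assert (HIc : convex_set I).
{ intros t1 t2 t H1 H2 Ht. destruct (Rle_dec 0 t).
  - destruct H2 as [->|[z [Hz [Hz'|Hz']]]].
    + left; lra.
    + right; exists z; split; auto; left; lra.
    + left; lra.
  - destruct H1 as [->|[z [Hz [Hz'|Hz']]]].
    + left; lra.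
    + left; lra.
    + right; exists z; split; auto; right; lra. }
assert (HIJ : forall t, I t -> J t).
{ intros t [->|[z [Hz [Hz'|Hz']]]]; auto; [apply (HJc 0 z)|apply (HJc z 0)]; auto. }
assert (HIT : forall t, I t -> Rabs t <= Rabs T).
{ intros t [->|[z [Hz Hz']]]; [rewrite Rabs_R0; apply Rabs_pos|].
  apply Rle_trans with T; [|apply Rle_abs]. specialize (HT z Hz).
  apply Rabs_le_between in HT. apply Rabs_le. lra. }
assert (I00 : I 0) by now left.
destruct (Hux I) as [M HM].
{ repeat split; auto. now exists (Rabs T). }
destruct (regularity_induction J I u m (fun t => multiplier w (v t)) rho r' alpha a kappa M
  (Rabs T))
  as [R1 R2]; auto.
- intros t x Ht. rewrite HA in Hm. specialize (Hm t x Ht).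
  apply is_derive_unique in Hm. rewrite <- Hm. symmetry. apply is_derive_unique.
  apply (unif_deriv_pointwise m (multiplier w (v t))). exact (flow_unif _ _ _ t Fm Ht).
- intros t x Ht. specialize (Hr t x Ht).
  apply is_derive_unique in Hr. rewrite <- Hr. symmetry. apply is_derive_unique.
  apply (unif_deriv_pointwise rho (r' t)). exact (flow_unif _ _ _ t Fr Ht).
- intros t j Ht. unfold m. rewrite (Derive_n_multiplier w q) by auto.
  rewrite Nat.add_comm, <- Derive_n_comp_fun.
  apply L2sq_second_derivative with q; auto. now apply smooth_Derive_n, Su.
- intros t x Ht. apply supnorm_le. now apply HM.
- apply sup_controlled_L2 in R1.
  destruct R1 as [Sr [C1 K1]]. destruct (R2 0%nat) as [[_ [C2 K2]] _].
  destruct (R2 k) as [[Sm [C3 K3]] [_ [C4 K4]]]. unfold one in *.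
  exists (2 ^ k * / (2 * PI) * (C2 + C3) + 2 ^ (S k) * / (2 * PI) * (C1 + C4)).
  intros t Ht0. assert (Ht := HI0 t Ht0).
  assert (Smt : smooth_circle (m t)) by exact (proj1 Fm t (HIJ t Ht)).
  destruct (sobolev_norm_sqr k (m t) Smt) as [p [Ep Hp]].
  destruct (sobolev_norm_sqr (S k) (rho t) (Sr t Ht)) as [p' [Ep' Hp']].
  replace (Aop s (u t)) with (m t) by (symmetry; apply Aop_multiplier).
  rewrite Ep, Ep'.
  specialize (K1 t Ht). specialize (K2 t Ht). specialize (K3 t Ht). specialize (K4 t Ht).
  change (L2sq (Derive_n (m t) 0)) with (L2sq (m t)) in K2.
  assert (Pos : 0 < / (2 * PI)) by (apply Rinv_0_lt_compat, two_PI_pos).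
  assert (Pk : 0 < 2 ^ k) by (apply pow_lt; lra). assert (Pk' : 0 < 2 ^ S k) by (apply pow_lt;
    lra).
  simpl. apply Rplus_le_compat.
  + eapply Rle_trans; [exact Hp|]. apply Rmult_le_compat_l; [nra|lra].
  + eapply Rle_trans; [exact Hp'|]. apply Rmult_le_compat_l; [nra|lra].
Qed.
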